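(* For any Hopf algebra $H$ over a field $k$, the algebra $\mathcal{B}_H$ is generated by the elements $p_x$, $p'_x$, $q_{x,y}$, $q'_{x,y}$ ($x,y\in H$).
   Context: $k$ is a field; algebras are associative unital $k$-algebras, coalgebras are coassociative counital $k$-coalgebras, and $\otimes=\otimes_k$. Sweedler notation without summation sign: $\Delta(x)=x_1\otimes x_2$, $\Delta^{(2)}(x)=x_1\otimes x_2\otimes x_3$, etc.; $\varepsilon$ is the counit and $S$ the antipode. Let $H$ be a Hopf algebra over $k$. Let $t_H$ be a copy of the underlying vector space of $H$, with identity map $H\to t_H$ written $x\mapsto t_x$, and let $S(t_H)$ be the symmetric algebra of $t_H$. There is a unique linear map $x\mapsto t^{-1}_x$ from $H$ to the field of fractions $\mathrm{Frac}\,S(t_H)$ such that $t_{x_1}t^{-1}_{x_2}=t^{-1}_{x_1}t_{x_2}=\varepsilon(x)1$ for all $x\in H$. $S(t_H)_\Theta$ denotes the subalgebra of $\mathrm{Frac}\,S(t_H)$ generated by all $t_x$ and $t_x^{-1}$ ($x\in H$). For $x,y\in H$ put $\sigma(x,y)=t_{x_1}t_{y_1}t^{-1}_{x_2y_2}$ and $\sigma^{-1}(x,y)=t_{x_1y_1}t^{-1}_{x_2}t^{-1}_{y_2}$ in $S(t_H)_\Theta$. $\mathcal{B}_H$ denotes the subalgebra of $S(t_H)_\Theta$ generated by all $\sigma(x,y)$ and $\sigma^{-1}(x,y)$, $x,y\in H$. Let $X_H$ be another copy of the vector space $H$, with identity map $x\mapsto X_x$, and let $T(X_H)$ be its tensor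 algebra. Let $\mu:T(X_H)\to S(t_H)\otimes H$ be the algebra morphism with $\mu(X_x)=t_{x_1}\otimes x_2$, and $\mu':T(X_H)\to S(t_H)_\Theta\otimes H$ the anti-algebra morphism with $\mu'(X_x)=t^{-1}_{x_2}\otimes S(x_1)$. Define $p_x=\mu(X_{x_1}X_{S(x_2)})$, $p'_x=\mu'(X_{S(x_1)}X_{x_2})$, $q_{x,y}=\mu(X_{x_1}X_{y_1}X_{S(x_2y_2)})$, $q'_{x,y}=\mu'(X_{S(x_1y_1)}X_{x_2}X_{y_2})$. These elements lie in $S(t_H)_\Theta\otimes 1$, which is identified with $S(t_H)_\Theta$; explicitly, $p_x=t_{x_1}t_{S(x_2)}$, $p'_x=t^{-1}_{S(x_1)}t^{-1}_{x_2}$, $q_{x,y}=t_{x_1}t_{y_1}t_{S(x_2y_2)}$, $q'_{x,y}=t^{-1}_{S(x_1y_1)}t^{-1}_{x_2}t^{-1}_{y_2}$. *)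

(* Defs.v *)
From HB Require Import structures.
From mathcomp Require Import all_boot all_algebra.
From mathcomp Require Import boolp classical_sets.
From mathcomp Require mpoly.

Set Implicit Arguments.
Unset Strict Implicit.
Unset Printing Implicit Defensive.

Import GRing.Theory.

Local Open Scope ring_scope.
Local Open Scope quotient_scope.

Section LinearForm.
Variables (k : fieldType) (V : lmodType k) (v : V).
Hypothesis v_neq0 : v != 0.

Let avoids (W : set V) :=
  ~ W v /\ forall (c : k) x y, W x -> W y -> W (c *: x + y).

Let ex_maximal : exists W : set V,
  [/\ ~ W v, W 0, forall (c : k) x y, W x -> W y -> W (c *: x + y)
    & forall u, exists c : k, W (u - c *: v)].
Proof.
have chainP (F : set (set V)) : (F `<=` avoids)%classic ->
    total_on F subset -> avoids (\bigcup_(X in F) X)%classic.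
  move=> FP Ftot; split=> [[X FX Xv]|c x y [X FX Xx] [Y FY Yy]].
    by case: (FP _ FX).
  have [XY|YX] := Ftot _ _ FX FY.
    by exists Y => //; apply: (proj2 (FP _ FY)) => //; apply: XY.
  by exists X => //; apply: (proj2 (FP _ FX)) => //; apply: YX.
have [W [[Wv Wlin] maxW]] := Zorn_bigcup chainP.
have W0 : W 0.
  apply: contrapT => nW0.
  have [[x Wx]|noW] := pselect (exists x, W x).
    by apply: nW0; have := Wlin (-1) x x Wx Wx; rewrite scaleN1r addNr.
  apply: (maxW [set 0]%classic).
    split; first by move=> x Wx; case: noW; exists x.
    by move=> /(_ 0 erefl).
  split=> [/= v0|c x y /= -> ->]; first by move/eqP: v_neq0; apply.
  by rewrite scaler0 addr0.
exists W; split=> // u.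
have [Wu|nWu] := pselect (W u); first by exists 0; rewrite scale0r subr0.
pose W' := [set x | exists c : k, W (x - c *: u)]%classic.
have WW' : (W `<=` W')%classic by move=> x Wx; exists 0; rewrite scale0r subr0.
have W'u : W' u by exists 1; rewrite scale1r subrr.
have W'lin (c : k) x y : W' x -> W' y -> W' (c *: x + y).
  move=> [a Wa] [b Wb]; exists (c * a + b).
  have -> : c *: x + y - (c * a + b) *: u
      = c *: (x - a *: u) + (y - b *: u).
    by rewrite scalerBr scalerDl scalerA opprD addrACA.
  exact: Wlin.
have [c Wc] : W' v.
  apply: contrapT => nW'v; apply: (maxW W'); last by split.
  by split=> // W'W; apply: nWu; apply: W'W.
have c0 : c != 0.
  by apply/eqP => c0; apply: Wv; rewrite c0 scale0r subr0 in Wc.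
exists c^-1.
have := Wlin (- c^-1) _ _ Wc W0.
by rewrite addr0 scalerBr scalerA mulNr mulVf // !scaleNr scale1r opprK addrC.
Qed.

Lemma ex_linear_form : exists f : {linear V -> k^o}, f v = 1.
Proof.
have [W [Wv W0 Wlin Wall]] := ex_maximal.
have WZ (c : k) x : W x -> W (c *: x) by move=> Wx; rewrite -[_ *: _]addr0; apply: Wlin.
have Wuniq u (a b : k) : W (u - a *: v) -> W (u - b *: v) -> a = b.
  move=> Wa Wb; apply/eqP; rewrite -subr_eq0; apply/negP => /negP ab0.
  have /(WZ (a - b)^-1) : W ((a - b) *: v).
    have := Wlin (-1) _ _ Wa Wb.
    by rewrite scaleN1r opprB addrA subrK -scalerBl.
  by rewrite scalerA mulVf // scale1r.
pose f u : k^o := sval (cid (Wall u)).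
have fP u : W (u - (f u : k) *: v) := svalP (cid (Wall u)).
have flin : linear f.
  move=> c x y; apply: (Wuniq (c *: x + y)) => //.
  have -> : c *: x + y - ((c *: f x + f y : k^o) : k) *: v
      = c *: (x - (f x : k) *: v) + (y - (f y : k) *: v).
    by rewrite scalerBr scalerDl scalerA opprD addrACA.
  exact: Wlin.
pose f' := GRing.isLinear.Build k V k^o _ f flin.
exists (HB.pack_for {linear V -> k^o} f f'); apply: (Wuniq v); first exact: fP.
by rewrite scale1r subrr.
Qed.

End LinearForm.

(** [U \ox V] is the space of formal finite sums of pairs, two sums being
    identified when every bilinear map takes the same value on them. *)

Notation bilin f := (bilinear_for *:%R *:%R f).

Section Tensor.
Variables (k : fieldType) (U V : lmodType k).
Implicit Types s : seq (U * V).

Definition tensor_eval (W : lmodType k) (f : U -> V -> W) s : W :=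
  \sum_(p <- s) f p.1 p.2.

Definition tensor_eqv s1 s2 : bool :=
  `[< forall (W : lmodType k) (f : U -> V -> W), bilin f ->
        tensor_eval f s1 = tensor_eval f s2 >].

Lemma tensor_eqv_refl : reflexive tensor_eqv.
Proof. by move=> s; apply/asboolP. Qed.

Lemma tensor_eqv_sym : symmetric tensor_eqv.
Proof. by move=> s s'; apply/asboolP/asboolP => e W f fb; rewrite e. Qed.

Lemma tensor_eqv_trans : transitive tensor_eqv.
Proof.
move=> s2 s1 s3 /asboolP e12 /asboolP e23.
by apply/asboolP => W f fb; rewrite e12 // e23.
Qed.

Canonical tensor_equiv :=
  EquivRel tensor_eqv tensor_eqv_refl tensor_eqv_sym tensor_eqv_trans.

Definition tensor := {eq_quot tensor_equiv}.
HB.instance Definition _ := Choice.on tensor.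
HB.instance Definition _ := EqQuotient.on tensor.

Definition tens (u : U) (v : V) : tensor := \pi_tensor [:: (u, v)].

(** The linear map [U \ox V -> W] induced by a bilinear [f]; it does not depend
    on the representative (lemmas [tliftE] and [tlift_linear] below). *)
Definition tlift (W : lmodType k) (f : U -> V -> W) (x : tensor) : W :=
  tensor_eval f (repr x).

Lemma tlift_pi (W : lmodType k) (f : U -> V -> W) s :
  bilin f -> tlift f (\pi_tensor s) = tensor_eval f s.
Proof.
have /eqquotP/asboolP e : \pi_tensor (repr (\pi_tensor s)) = \pi_tensor s :> tensor.
  by rewrite reprK.
exact: e.
Qed.

Lemma tensor_ext (x y : tensor) :
  (forall (W : lmodType k) (f : U -> V -> W), bilin f -> tlift f x = tlift f y) ->
  x = y.
Proof.
by move=> e; rewrite -[x]reprK -[y]reprK; apply/eqquotP/asboolP.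
Qed.

Let tadd (x y : tensor) : tensor := \pi_tensor (repr x ++ repr y).
Let tscale (c : k) (x : tensor) : tensor :=
  \pi_tensor [seq (c *: p.1, p.2) | p <- repr x].
Let tzero : tensor := \pi_tensor [::].

Let tliftD (W : lmodType k) (f : U -> V -> W) (x y : tensor) : bilin f ->
  tlift f (tadd x y) = tlift f x + tlift f y.
Proof. by move=> fb; rewrite tlift_pi // /tensor_eval big_cat. Qed.

Let tlift0 (W : lmodType k) (f : U -> V -> W) : bilin f -> tlift f tzero = 0.
Proof. by move=> fb; rewrite tlift_pi // /tensor_eval big_nil. Qed.

Lemma bilinZl (W : lmodType k) (f : U -> V -> W) : bilin f ->
  forall c u v, f (c *: u) v = c *: f u v.
Proof. by move=> [fl fr] c u v; exact: (scalable_linear (fl v) c u). Qed.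
Lemma bilinZr (W : lmodType k) (f : U -> V -> W) : bilin f ->
  forall c u v, f u (c *: v) = c *: f u v.
Proof. by move=> [fl fr] c u v; exact: (scalable_linear (fr u) c v). Qed.
Lemma bilinDl (W : lmodType k) (f : U -> V -> W) : bilin f ->
  forall u u' v, f (u + u') v = f u v + f u' v.
Proof. by move=> [fl fr] u u' v; have /= := fl v 1 u u'; rewrite !scale1r => ->. Qed.
Lemma bilinDr (W : lmodType k) (f : U -> V -> W) : bilin f ->
  forall u v v', f u (v + v') = f u v + f u v'.
Proof. by move=> [fl fr] u v v'; have /= := fr u 1 v v'; rewrite !scale1r => ->. Qed.

Let tliftZ (W : lmodType k) (f : U -> V -> W) c (x : tensor) : bilin f ->
  tlift f (tscale c x) = c *: tlift f x.
Proof.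
move=> fb; rewrite tlift_pi // /tlift /tensor_eval big_map scaler_sumr.
by apply: eq_bigr => p _; rewrite /= bilinZl.
Qed.

Let taddA : associative tadd.
Proof. by move=> x y z; apply: tensor_ext => W f fb; rewrite !tliftD // addrA. Qed.
Let taddC : commutative tadd.
Proof. by move=> x y; apply: tensor_ext => W f fb; rewrite !tliftD // addrC. Qed.
Let tadd0 : left_id tzero tadd.
Proof. by move=> x; apply: tensor_ext => W f fb; rewrite tliftD // tlift0 // add0r. Qed.
Let taddN : left_inverse tzero (tscale (-1)) tadd.
Proof.
move=> x; apply: tensor_ext => W f fb.
by rewrite tliftD // tliftZ // tlift0 // scaleN1r addNr.
Qed.

HB.instance Definition _ := GRing.isZmodule.Build tensor taddA taddC tadd0 taddN.

Let tscaleA a b x : tscale a (tscale b x) = tscale (a * b) x.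
Proof. by apply: tensor_ext => W f fb; rewrite !tliftZ // scalerA. Qed.
Let tscale1 : left_id 1 tscale.
Proof. by move=> x; apply: tensor_ext => W f fb; rewrite tliftZ // scale1r. Qed.
Let tscaleDr : right_distributive tscale +%R.
Proof.
by move=> a x y; apply: tensor_ext => W f fb; rewrite tliftZ // !tliftD // !tliftZ // scalerDr.
Qed.
Let tscaleDl x : {morph tscale^~ x : a b / a + b}.
Proof.
by move=> a b; apply: tensor_ext => W f fb; rewrite tliftD // !tliftZ // scalerDl.
Qed.

HB.instance Definition _ :=
  GRing.Zmodule_isLmodule.Build k tensor tscaleA tscale1 tscaleDr tscaleDl.

Lemma tens_bilin : bilin tens.
Proof.
split=> [v|u] c x y; apply: tensor_ext => W f fb; rewrite tliftD // tliftZ // !tlift_pi //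
  /tensor_eval !big_seq1 /=; case: fb => fl fr; [exact: fl | exact: fr].
Qed.

Lemma tliftE (W : lmodType k) (f : U -> V -> W) u v :
  bilin f -> tlift f (tens u v) = f u v.
Proof. by move=> fb; rewrite tlift_pi // /tensor_eval big_seq1. Qed.

Lemma tlift_linear (W : lmodType k) (f : U -> V -> W) :
  bilin f -> linear (tlift f).
Proof. by move=> fb c x y; rewrite tliftD // tliftZ. Qed.

Definition tlift_lin (W : lmodType k) (f : U -> V -> W) (fb : bilin f) :
    {linear tensor -> W} :=
  HB.pack_for {linear tensor -> W} (tlift f)
    (GRing.isLinear.Build k tensor W _ (tlift f) (tlift_linear fb)).

Lemma tensor_sum (x : tensor) : x = \sum_(p <- repr x) tens p.1 p.2.
Proof.
apply: tensor_ext => W f fb.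
rewrite [RHS](_ : _ = tlift_lin fb (\sum_(p <- repr x) tens p.1 p.2)) // linear_sum /=.
by rewrite /tlift; apply: eq_bigr => p _; rewrite -/(tlift f (tens _ _)) tliftE.
Qed.

Lemma tlift_unique (W : lmodType k) (f : U -> V -> W) (g : {linear tensor -> W}) :
  bilin f -> (forall u v, g (tens u v) = f u v) -> g =1 tlift f.
Proof.
move=> fb gE x; rewrite [x in LHS]tensor_sum linear_sum.
by apply: eq_bigr => p _; apply: gE.
Qed.

Lemma tensor_ind (P : tensor -> Prop) :
  (forall u v, P (tens u v)) -> P 0 -> (forall x y, P x -> P y -> P (x + y)) ->
  forall x, P x.
Proof.
by move=> Pt P0 PD x; rewrite [x]tensor_sum; elim/big_ind: _.
Qed.

End Tensor.

Arguments tensor {k} (U V)%_type_scope.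
Reserved Notation "U \ox V" (at level 40, left associativity).
Notation "U \ox V" := (tensor U V) : type_scope.
Notation "u \ox v" := (tens u v) : ring_scope.

Section TensorFamily.
Variables (k : fieldType) (U V U' V' W : lmodType k).
Implicit Types F : U -> V -> U' -> V' -> W.

Lemma tlift_bilin F (y : U' \ox V') :
  (forall u' v', bilin (fun u v => F u v u' v')) ->
  bilin (fun u v => tlift (F u v) y).
Proof.
move=> Fb; rewrite /tlift /tensor_eval.
split=> [v|u] c x x'; rewrite /= scaler_sumr -big_split; apply: eq_bigr => p _.
  by case: (Fb p.1 p.2) => fl _; apply: fl.
by case: (Fb p.1 p.2) => _ fr; apply: fr.
Qed.

Lemma bilin_comp (g : {linear U -> U'}) (h : {linear V -> V'}) (f : U' -> V' -> W) :
  bilin f -> bilin (fun u v => f (g u) (h v)).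
Proof.
move=> [fl fr]; split=> [v|u] c x y; rewrite /= linearP; first exact: fl.
exact: fr.
Qed.

End TensorFamily.

Section TensorMap.
Variables (k : fieldType) (U V W U' V' : lmodType k).

Definition tmap (f : U -> U') (g : V -> V') : U \ox V -> U' \ox V' :=
  tlift (fun u v => f u \ox g v).

Definition tassoc : (U \ox V) \ox W -> U \ox (V \ox W) :=
  tlift (fun x w => tlift (fun u v => u \ox (v \ox w)) x).

End TensorMap.

Section TensorAlgebra.
Variables (k : fieldType) (A B : algType k).
Implicit Types x y z : A \ox B.

Let tmul x y : A \ox B :=
  tlift (fun a b => tlift (fun a' b' => (a * a') \ox (b * b')) y) x.

Let inner_bilin (a : A) (b : B) : bilin (fun a' b' => (a * a') \ox (b * b')).
Proof.
have [tl tr] := @tens_bilin k A B.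
split=> [b'|a'] c u v; rewrite /= mulrDr -scalerAr; first exact: tl.
exact: tr.
Qed.

Let outer_bilin y : bilin (fun a b => tlift (fun a' b' => (a * a') \ox (b * b')) y).
Proof.
apply: tlift_bilin => a' b'; have [tl tr] := @tens_bilin k A B.
split=> [b|a] c u v; rewrite /= mulrDl -scalerAl; first exact: tl.
exact: tr.
Qed.

Lemma tlift_eq (U V W : lmodType k) (f g : U -> V -> W) (x : U \ox V) :
  f =2 g -> tlift f x = tlift g x.
Proof. by move=> fg; apply: eq_bigr => p _; rewrite fg. Qed.

Let tmulE (a a' : A) (b b' : B) : tmul (a \ox b) (a' \ox b') = (a * a') \ox (b * b').
Proof. by rewrite /tmul !tliftE. Qed.

Let tmulP c x x' y : tmul (c *: x + x') y = c *: tmul x y + tmul x' y.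
Proof. exact: (linearP (tlift_lin (outer_bilin y))). Qed.

Let tmulPr c x y y' : tmul x (c *: y + y') = c *: tmul x y + tmul x y'.
Proof.
rewrite /tmul [in RHS]/tlift /tensor_eval scaler_sumr -big_split; apply: eq_bigr => p _.
exact: (linearP (tlift_lin (inner_bilin p.1 p.2))).
Qed.

Let tmulDl : left_distributive tmul +%R.
Proof. by move=> x y z; have := tmulP 1 x y z; rewrite !scale1r => ->. Qed.
Let tmulDr : right_distributive tmul +%R.
Proof. by move=> x y z; have := tmulPr 1 x y z; rewrite !scale1r => ->. Qed.
Let tmul0l x : tmul 0 x = 0.
Proof. by apply: (addrI (tmul 0 x)); rewrite -tmulDl !addr0. Qed.
Let tmul0r x : tmul x 0 = 0.
Proof. by apply: (addrI (tmul x 0)); rewrite -tmulDr !addr0. Qed.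

Let tmulA : associative tmul.
Proof.
move=> x y z.
elim/tensor_ind: x => [a b||x x' Ex Ex']; last 2 first.
- by rewrite !tmul0l.
- by rewrite !tmulDl Ex Ex'.
elim/tensor_ind: y => [a' b'||y y' Ey Ey']; last 2 first.
- by rewrite !(tmul0l, tmul0r).
- by rewrite !(tmulDl, tmulDr) Ey Ey'.
elim/tensor_ind: z => [a'' b''||z z' Ez Ez']; last 2 first.
- by rewrite !tmul0r.
- by rewrite !tmulDr Ez Ez'.
by rewrite !tmulE !mulrA.
Qed.

Let tmul1l : left_id (1 \ox 1) tmul.
Proof.
by elim/tensor_ind=> [a b||x y Ex Ey]; rewrite ?tmul0r ?tmulDr ?Ex ?Ey ?tmulE ?mul1r.
Qed.
Let tmul1r : right_id (1 \ox 1) tmul.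
Proof.
by elim/tensor_ind=> [a b||x y Ex Ey]; rewrite ?tmul0l ?tmulDl ?Ex ?Ey ?tmulE ?mulr1.
Qed.

Let tone_neq0 : (1 : A) \ox (1 : B) != 0.
Proof.
have [f f1] := ex_linear_form (oner_neq0 A).
have [g g1] := ex_linear_form (oner_neq0 B).
have fgb : bilin (fun a b => f a * g b : k^o).
  split=> [b|a] c u v /=; rewrite linearP.
    by rewrite mulrDl -scalerAl.
  by rewrite mulrDr -scalerAr.
apply/eqP => /(congr1 (tlift_lin fgb)).
by rewrite linear0 /= tliftE // f1 g1 mulr1 => /eqP; rewrite oner_eq0.
Qed.

HB.instance Definition _ := GRing.Zmodule_isNzRing.Build (tensor A B)
  tmulA tmul1l tmul1r tmulDl tmulDr tone_neq0.

Let tscaleAl (c : k) x y : c *: (x * y) = (c *: x) * y.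
Proof. by have := tmulP c x 0 y; rewrite tmul0l !addr0 => /esym. Qed.
Let tscaleAr (c : k) x y : c *: (x * y) = x * (c *: y).
Proof. by have := tmulPr c x y 0; rewrite tmul0r !addr0 => /esym. Qed.

HB.instance Definition _ := GRing.Lmodule_isLalgebra.Build k (tensor A B) tscaleAl.
HB.instance Definition _ := GRing.Lalgebra_isAlgebra.Build k (tensor A B) tscaleAr.

Lemma tensM (a a' : A) (b b' : B) : (a \ox b) * (a' \ox b') = (a * a') \ox (b * b').
Proof. exact: tmulE. Qed.

Lemma tens1 : 1 = 1 \ox 1 :> A \ox B.
Proof. by []. Qed.

End TensorAlgebra.

(** The tensor and symmetric algebras consist of algebra expressions in the vectors of [V], two expressions
    being identified when they take the same value under every linear map from
    [V] to an algebra (tensor algebra, [comm = false]), resp. to a commutative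
    algebra (symmetric algebra, [comm = true]). *)

Section FreeAlgebra.
Variables (k : fieldType) (comm : bool) (V : lmodType k).

Inductive aexpr :=
  | AGen of V
  | ACst of k
  | AAdd of aexpr & aexpr
  | AMul of aexpr & aexpr.

HB.instance Definition _ := gen_eqMixin aexpr.
HB.instance Definition _ := gen_choiceMixin aexpr.

Fixpoint aexpr_eval (A : algType k) (f : V -> A) (e : aexpr) : A :=
  match e with
  | AGen v => f v
  | ACst c => c%:A
  | AAdd e1 e2 => aexpr_eval f e1 + aexpr_eval f e2
  | AMul e1 e2 => aexpr_eval f e1 * aexpr_eval f e2
  end.

Definition admissible (A : algType k) := comm -> commutative (@GRing.mul A).

Definition aexpr_eqv e1 e2 : bool :=
  `[< forall (A : algType k) (f : {linear V -> A}), admissible A ->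
        aexpr_eval f e1 = aexpr_eval f e2 >].

Lemma aexpr_eqv_refl : reflexive aexpr_eqv.
Proof. by move=> e; apply/asboolP. Qed.

Lemma aexpr_eqv_sym : symmetric aexpr_eqv.
Proof. by move=> e e'; apply/asboolP/asboolP => E A f cA; rewrite E. Qed.

Lemma aexpr_eqv_trans : transitive aexpr_eqv.
Proof.
move=> e2 e1 e3 /asboolP e12 /asboolP e23.
by apply/asboolP => A f cA; rewrite e12 // e23.
Qed.

Canonical aexpr_equiv :=
  EquivRel aexpr_eqv aexpr_eqv_refl aexpr_eqv_sym aexpr_eqv_trans.

Definition freealg := {eq_quot aexpr_equiv}.
HB.instance Definition _ := Choice.on freealg.
HB.instance Definition _ := EqQuotient.on freealg.
Implicit Types x y z : freealg.

Definition fa_eval (A : algType k) (f : V -> A) x : A := aexpr_eval f (repr x).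

Lemma fa_eval_pi (A : algType k) (f : {linear V -> A}) e :
  admissible A -> fa_eval f (\pi_freealg e) = aexpr_eval f e.
Proof.
have /eqquotP/asboolP E : \pi_freealg (repr (\pi_freealg e)) = \pi_freealg e :> freealg.
  by rewrite reprK.
exact: E.
Qed.

Lemma freealg_ext x y :
  (forall (A : algType k) (f : {linear V -> A}), admissible A ->
     fa_eval f x = fa_eval f y) -> x = y.
Proof. by move=> E; rewrite -[x]reprK -[y]reprK; apply/eqquotP/asboolP. Qed.

Let fcst c : freealg := \pi_freealg (ACst c).
Let fadd x y : freealg := \pi_freealg (AAdd (repr x) (repr y)).
Let fmul x y : freealg := \pi_freealg (AMul (repr x) (repr y)).
Let fscale c x : freealg := fmul (fcst c) x.
Let fopp x : freealg := fscale (-1) x.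

Let evalD (A : algType k) (f : {linear V -> A}) x y : admissible A ->
  fa_eval f (fadd x y) = fa_eval f x + fa_eval f y.
Proof. by move=> cA; rewrite fa_eval_pi. Qed.
Let evalM (A : algType k) (f : {linear V -> A}) x y : admissible A ->
  fa_eval f (fmul x y) = fa_eval f x * fa_eval f y.
Proof. by move=> cA; rewrite fa_eval_pi. Qed.
Let evalC (A : algType k) (f : {linear V -> A}) c : admissible A ->
  fa_eval f (fcst c) = c%:A.
Proof. by move=> cA; rewrite fa_eval_pi. Qed.
Let evalZ (A : algType k) (f : {linear V -> A}) c x : admissible A ->
  fa_eval f (fscale c x) = c *: fa_eval f x.
Proof. by move=> cA; rewrite evalM // evalC // mulr_algl. Qed.
Let evalN (A : algType k) (f : {linear V -> A}) x : admissible A ->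
  fa_eval f (fopp x) = - fa_eval f x.
Proof. by move=> cA; rewrite evalZ // scaleN1r. Qed.

Let faddA : associative fadd.
Proof. by move=> x y z; apply: freealg_ext => A f cA; rewrite !evalD // addrA. Qed.
Let faddC : commutative fadd.
Proof. by move=> x y; apply: freealg_ext => A f cA; rewrite !evalD // addrC. Qed.
Let fadd0 : left_id (fcst 0) fadd.
Proof.
by move=> x; apply: freealg_ext => A f cA; rewrite evalD // evalC // scale0r add0r.
Qed.
Let faddN : left_inverse (fcst 0) fopp fadd.
Proof.
by move=> x; apply: freealg_ext => A f cA; rewrite evalD // evalC // evalN // scale0r addNr.
Qed.
HB.instance Definition _ := GRing.isZmodule.Build freealg faddA faddC fadd0 faddN.

Let fmulA : associative fmul.
Proof. by move=> x y z; apply: freealg_ext => A f cA; rewrite !evalM // mulrA. Qed.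
Let fmul1l : left_id (fcst 1) fmul.
Proof.
by move=> x; apply: freealg_ext => A f cA; rewrite evalM // evalC // scale1r mul1r.
Qed.
Let fmul1r : right_id (fcst 1) fmul.
Proof.
by move=> x; apply: freealg_ext => A f cA; rewrite evalM // evalC // scale1r mulr1.
Qed.
Let fmulDl : left_distributive fmul fadd.
Proof.
by move=> x y z; apply: freealg_ext => A f cA; rewrite !(evalM, evalD) // mulrDl.
Qed.
Let fmulDr : right_distributive fmul fadd.
Proof.
by move=> x y z; apply: freealg_ext => A f cA; rewrite !(evalM, evalD) // mulrDr.
Qed.
Let fone_neq0 : fcst 1 != fcst 0.
Proof.
have cA : admissible k^o by move=> _; exact: mulrC.
apply/eqP => /(congr1 (fa_eval (\0 : {linear V -> k^o}))).
by rewrite !evalC // scale0r scale1r => /eqP; rewrite oner_eq0.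
Qed.
HB.instance Definition _ :=
  GRing.Zmodule_isNzRing.Build freealg fmulA fmul1l fmul1r fmulDl fmulDr fone_neq0.

Let fscaleA a b x : fscale a (fscale b x) = fscale (a * b) x.
Proof. by apply: freealg_ext => A f cA; rewrite !evalZ // scalerA. Qed.
Let fscale1 : left_id 1 fscale.
Proof. by move=> x; apply: freealg_ext => A f cA; rewrite evalZ // scale1r. Qed.
Let fscaleDr : right_distributive fscale fadd.
Proof. by move=> a x y; apply: freealg_ext => A f cA; rewrite !(evalZ, evalD) // scalerDr. Qed.
Let fscaleDl x : {morph fscale^~ x : a b / a + b >-> fadd a b}.
Proof. by move=> a b; apply: freealg_ext => A f cA; rewrite !(evalZ, evalD) // scalerDl. Qed.
HB.instance Definition _ :=
  GRing.Zmodule_isLmodule.Build k freealg fscaleA fscale1 fscaleDr fscaleDl.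

Let fscaleAl c x y : fscale c (fmul x y) = fmul (fscale c x) y.
Proof. by apply: freealg_ext => A f cA; rewrite !(evalZ, evalM) // scalerAl. Qed.
Let fscaleAr c x y : fscale c (fmul x y) = fmul x (fscale c y).
Proof. by apply: freealg_ext => A f cA; rewrite !(evalZ, evalM) // scalerAr. Qed.
HB.instance Definition _ := GRing.Lmodule_isLalgebra.Build k freealg fscaleAl.
HB.instance Definition _ := GRing.Lalgebra_isAlgebra.Build k freealg fscaleAr.

Lemma freealg_mulC : comm -> commutative (@GRing.mul freealg).
Proof.
move=> c x y; apply: freealg_ext => A f cA.
by rewrite [LHS]evalM // [RHS]evalM // cA.
Qed.

Lemma fa_gen_linear : linear (fun v => \pi_freealg (AGen v) : freealg).
Proof.
move=> c u v; apply: freealg_ext => A f cA.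
by rewrite evalD // evalZ // !fa_eval_pi //= linearP.
Qed.

Definition fa_gen (v : V) : freealg := \pi_freealg (AGen v).
HB.instance Definition _ := GRing.isLinear.Build k V freealg _ fa_gen fa_gen_linear.

Section Lift.
Variables (A : algType k) (f : {linear V -> A}) (cA : admissible A).

Definition fa_lift_fun & admissible A := fa_eval f.

Lemma fa_lift_linear : linear (fa_lift_fun cA).
Proof. by move=> c x y; rewrite /fa_lift_fun evalD // evalZ. Qed.
Lemma fa_lift_monoid : monoid_morphism (fa_lift_fun cA).
Proof.
by split=> [|x y]; rewrite /fa_lift_fun ?evalM // [LHS]evalC // scale1r.
Qed.
HB.instance Definition _ :=
  GRing.isLinear.Build k freealg A _ (fa_lift_fun cA) fa_lift_linear.
HB.instance Definition _ :=
  GRing.isMonoidMorphism.Build freealg A (fa_lift_fun cA) fa_lift_monoid.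

Definition fa_lift : {lrmorphism freealg -> A} := fa_lift_fun cA.

Lemma fa_liftE v : fa_lift (fa_gen v) = f v.
Proof. by rewrite /= /fa_lift_fun fa_eval_pi. Qed.

End Lift.

Lemma freealg_ind (P : freealg -> Prop) :
  (forall v, P (fa_gen v)) -> (forall c, P c%:A) ->
  (forall x y, P x -> P y -> P (x + y)) ->
  (forall x y, P x -> P y -> P (x * y)) ->
  forall x, P x.
Proof.
move=> Pg Pc PD PM x; rewrite -[x]reprK.
have piD e1 e2 : \pi_freealg (AAdd e1 e2) = \pi_freealg e1 + \pi_freealg e2 :> freealg.
  by apply: freealg_ext => A f cA; rewrite evalD // !fa_eval_pi.
have piM e1 e2 : \pi_freealg (AMul e1 e2) = \pi_freealg e1 * \pi_freealg e2 :> freealg.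
  by apply: freealg_ext => A f cA; rewrite evalM // !fa_eval_pi.
have piC c : \pi_freealg (ACst c) = c%:A :> freealg.
  by apply: freealg_ext => A f cA; rewrite evalZ // !fa_eval_pi //= scale1r.
elim: (repr x) => [v|c|e1 I1 e2 I2|e1 I1 e2 I2].
- exact: Pg.
- by rewrite piC; apply: Pc.
- by rewrite piD; apply: PD.
- by rewrite piM; apply: PM.
Qed.

Lemma fa_lift_unique (A : algType k) (g g' : {lrmorphism freealg -> A}) :
  (forall v, g (fa_gen v) = g' (fa_gen v)) -> g =1 g'.
Proof.
move=> E; elim/freealg_ind=> [v|c|x y Ex Ey|x y Ex Ey]; first exact: E.
- by rewrite !linearZ !rmorph1.
- by rewrite !rmorphD /= Ex Ey.
- by rewrite !rmorphM /= Ex Ey.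
Qed.

End FreeAlgebra.

Section TensorAlgebraOfSpace.
Variables (k : fieldType) (V : lmodType k).

Definition talg := freealg false V.
HB.instance Definition _ := GRing.Algebra.on talg.

Definition tgen : {linear V -> talg} := @fa_gen k false V.

Lemma talg_admissible (A : algType k) : admissible false A.
Proof. by []. Qed.

Definition talg_lift (A : algType k) (f : {linear V -> A}) : {lrmorphism talg -> A} :=
  fa_lift f (@talg_admissible A).

Lemma talg_liftE (A : algType k) (f : {linear V -> A}) v : talg_lift f (tgen v) = f v.
Proof. exact: fa_liftE. Qed.

End TensorAlgebraOfSpace.

Section SymmetricAlgebra.
Variables (k : fieldType) (V : lmodType k).

Definition sym := freealg true V.
HB.instance Definition _ := GRing.Algebra.on sym.
HB.instance Definition _ :=
  GRing.PzRing_hasCommutativeMul.Build sym (@freealg_mulC k true V isT).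

Definition sgen : {linear V -> sym} := @fa_gen k true V.

Lemma sym_admissible (A : comAlgType k) : admissible true A.
Proof. by move=> _; exact: mulrC. Qed.

Definition sym_lift (A : comAlgType k) (f : {linear V -> A}) : {lrmorphism sym -> A} :=
  fa_lift f (@sym_admissible A).

Lemma sym_liftE (A : comAlgType k) (f : {linear V -> A}) v : sym_lift f (sgen v) = f v.
Proof. exact: fa_liftE. Qed.

End SymmetricAlgebra.

(** The symmetric algebra is a domain: finitely many of its elements lie in the
    image of a polynomial ring that is a retract of it. *)

Section SymmetricDomain.
Import mpoly.
Variables (k : fieldType) (V : lmodType k).
Implicit Types l : seq ({linear V -> k^o} * V).

Let coord l (v : V) : V := \sum_(p <- l) (p.1 v : k) *: p.2.

Let coord_linear l : linear (coord l).
Proof.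
move=> c u v; rewrite /coord scaler_sumr -big_split; apply: eq_bigr => p _ /=.
by rewrite linearP scalerDl scalerA.
Qed.

Let ex_coord (s : seq V) : exists l, forall v, v \in s -> coord l v = v.
Proof.
elim: s => [|v s [l lE]]; first by exists [::].
pose w := v - coord l v; have [w0|w0] := eqVneq w 0.
  exists l => u; rewrite inE => /predU1P[->|/lE //].
  by apply/esym/eqP; rewrite -subr_eq0 -/w w0.
have [f f1] := ex_linear_form w0.
pose h u : k^o := f (u - coord l u).
have hlin : linear h.
  by move=> c x y; rewrite /h coord_linear opprD addrACA -scalerBr linearP.
pose h' : {linear V -> k^o} :=
  HB.pack_for {linear V -> k^o} h (GRing.isLinear.Build k V k^o _ h hlin).
have consE u : coord ((h', w) :: l) u = (h u : k) *: w + coord l u.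
  by rewrite /coord big_cons.
exists ((h', w) :: l) => u; rewrite consE inE => /predU1P[->|us].
  by rewrite /h -/w f1 scale1r subrK.
by rewrite /h lE // subrr linear0 scale0r add0r.
Qed.

Let R l := ({mpoly k[size l]} : comAlgType k).

Let nthl l (i : 'I_(size l)) := tnth (in_tuple l) i.

Let toR_fun l (v : V) : R l :=
  \sum_(i < size l) ((nthl i).1 v : k) *: (mpolyX k (mpoly.mnm1 i) : R l).

Let toR_linear l : linear (@toR_fun l).
Proof.
move=> c u v; rewrite /toR_fun scaler_sumr -big_split; apply: eq_bigr => i _ /=.
by rewrite linearP scalerDl scalerA.
Qed.

Let toR l : {linear V -> R l} := HB.pack_for {linear V -> R l} (@toR_fun l)
  (GRing.isLinear.Build k V (R l) _ (@toR_fun l) (@toR_linear l)).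

Let Phi l : {lrmorphism sym V -> R l} := sym_lift (toR l).

Let Psi l (p : R l) : sym V :=
  mmap (in_alg (sym V)) (fun i : 'I_(size l) => sgen V (nthl i).2) p.

Let PsiD l (p q : R l) : Psi (p + q) = Psi p + Psi q.
Proof. exact: raddfD. Qed.
Let PsiM l (p q : R l) : Psi (p * q) = Psi p * Psi q.
Proof. exact: rmorphM. Qed.

Let PsiK (x : sym V) : exists s : seq V,
  forall l, (forall v, v \in s -> coord l v = v) -> Psi (Phi l x) = x.
Proof.
elim/freealg_ind: x => [v|c|x y [s1 E1] [s2 E2]|x y [s1 E1] [s2 E2]].
- exists [:: v] => l /(_ v); rewrite inE eqxx => /(_ isT) lv.
  rewrite [Phi l _]sym_liftE /= /toR_fun /Psi raddf_sum /=.
  rewrite -[in RHS]lv /coord linear_sum [in RHS]big_tnth.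
  apply: eq_bigr => i _; rewrite mmapZ mmapX mmap1U linearZ /=.
  by rewrite mulr_algl.
- exists [::] => l _; rewrite linearZ rmorph1 /= /Psi mmapZ rmorph1 mulr1.
  by [].
- exists (s1 ++ s2) => l lE; rewrite rmorphD PsiD.
  by rewrite E1 ?E2 // => v vs; apply: lE; rewrite mem_cat vs ?orbT.
- exists (s1 ++ s2) => l lE; rewrite rmorphM PsiM.
  by rewrite E1 ?E2 // => v vs; apply: lE; rewrite mem_cat vs ?orbT.
Qed.

Lemma sym_integral (x y : sym V) : x * y = 0 -> (x == 0) || (y == 0).
Proof.
move=> xy0; have [[s1 E1] [s2 E2]] := (PsiK x, PsiK y).
have [l lE] := ex_coord (s1 ++ s2).
have /eqP : Phi l x * Phi l y = 0 by rewrite -rmorphM xy0 rmorph0.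
have Psi0 : Psi (0 : R l) = 0 by exact: raddf0.
rewrite (@mulf_eq0 {mpoly k[size l]}) => /orP[] /eqP e0; apply/orP; [left|right].
  by rewrite -(E1 l) ?e0 ?Psi0 // => v vs; apply: lE; rewrite mem_cat vs.
by rewrite -(E2 l) ?e0 ?Psi0 // => v vs; apply: lE; rewrite mem_cat vs orbT.
Qed.

Let sunit : {pred sym V} := fun x => `[< exists y, y * x = 1 >].
Let sinv (x : sym V) : sym V :=
  if pselect (exists y, y * x = 1) is left e then sval (cid e) else x.

Let mulVs : {in sunit, left_inverse 1 sinv *%R}.
Proof.
move=> x /asboolP xu; rewrite /sinv; case: pselect => // e; exact: svalP (cid e).
Qed.
Let sunitP (x y : sym V) : y * x = 1 -> sunit x.
Proof. by move=> yx; apply/asboolP; exists y. Qed.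
Let sinv_out : {in [predC sunit], sinv =1 id}.
Proof.
by move=> x /asboolP nu; rewrite /sinv; case: pselect.
Qed.

HB.instance Definition _ :=
  GRing.ComNzRing_hasMulInverse.Build (sym V) mulVs sunitP sinv_out.
HB.instance Definition _ := GRing.ComUnitRing_isIntegral.Build (sym V) sym_integral.

End SymmetricDomain.

Section SymmetricFractions.
Variables (k : fieldType) (V : lmodType k).

Definition symfrac : Type := {fraction (sym V)}.
HB.instance Definition _ := GRing.Field.on symfrac.

Definition symfrac_of (x : sym V) : symfrac := tofrac x.
HB.instance Definition _ := GRing.RMorphism.copy symfrac_of (@tofrac (sym V)).

Let fscale (c : k) (x : symfrac) : symfrac := symfrac_of c%:A * x.

Let fscaleA a b x : fscale a (fscale b x) = fscale (a * b) x.
Proof. by rewrite /fscale mulrA -rmorphM mulr_algl scalerA. Qed.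
Let fscale1 : left_id 1 fscale.
Proof. by move=> x; rewrite /fscale scale1r rmorph1 mul1r. Qed.
Let fscaleDr : right_distributive fscale +%R.
Proof. by move=> a x y; rewrite /fscale mulrDr. Qed.
Let fscaleDl x : {morph fscale^~ x : a b / a + b}.
Proof. by move=> a b; rewrite /fscale scalerDl rmorphD mulrDl. Qed.
HB.instance Definition _ :=
  GRing.Zmodule_isLmodule.Build k symfrac fscaleA fscale1 fscaleDr fscaleDl.

Let fscaleAl c (x y : symfrac) : c *: (x * y) = (c *: x) * y.
Proof. exact: mulrA. Qed.
HB.instance Definition _ := GRing.Lmodule_isLalgebra.Build k symfrac fscaleAl.
HB.instance Definition _ := GRing.Lalgebra_isComAlgebra.Build k symfrac.

Lemma symfrac_of_scalable : scalable symfrac_of.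
Proof. by move=> c x; rewrite -mulr_algl rmorphM. Qed.
HB.instance Definition _ :=
  GRing.isScalable.Build k (sym V) symfrac *:%R symfrac_of symfrac_of_scalable.

End SymmetricFractions.

Section GeneratedSubalgebra.
Variables (k : fieldType) (A : algType k).

Definition subalg_gen (G : set A) : {pred A} := fun x =>
  `[< forall P : {pred A}, subalg_closed P -> (forall g, G g -> g \in P) -> x \in P >].

Lemma subalg_gen_closed (G : set A) : subalg_closed (subalg_gen G).
Proof.
split=> [|c x y /asboolP Gx /asboolP Gy|x y /asboolP Gx /asboolP Gy];
  apply/asboolP => P PA PG; case: (PA) => P1 Plin PM //.
  by apply: Plin; [apply: Gx | apply: Gy].
by apply: PM; [apply: Gx | apply: Gy].
Qed.
HB.instance Definition _ (G : set A) :=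
  GRing.isSubalgClosed.Build k A (subalg_gen G) (subalg_gen_closed G).

Lemma mem_subalg_gen (G : set A) g : G g -> g \in subalg_gen G.
Proof. by move=> Gg; apply/asboolP => P _; apply. Qed.

Lemma subalg_gen_min (G : set A) (P : {pred A}) :
  subalg_closed P -> (forall g, G g -> g \in P) -> {subset subalg_gen G <= P}.
Proof. by move=> PA PG x /asboolP; apply. Qed.

End GeneratedSubalgebra.

Section GeneratedSubalgebraType.
Variables (k : fieldType) (A : comAlgType k) (G : set A).

Definition subalg : Type := {x : A | x \in subalg_gen G}.
HB.instance Definition _ := SubChoice.on subalg.
HB.instance Definition _ := [SubChoice_isSubAlgebra of subalg by <:].
HB.instance Definition _ := [SubNzRing_isSubComNzRing of subalg by <:].

End GeneratedSubalgebraType.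

(** The converse algebra; a morphism to [A^c] is an anti-morphism to [A]. *)

Section ConverseAlgebra.
Variables (k : fieldType) (A : algType k).

HB.instance Definition _ := GRing.Lmodule.copy A^c A.

Let cscaleAl (c : k) (x y : A^c) : c *: (x * y) = (c *: x : A^c) * y.
Proof. exact: (@scalerAr k A c y x). Qed.
Let cscaleAr (c : k) (x y : A^c) : c *: (x * y) = x * (c *: y : A^c).
Proof. exact: (@scalerAl k A c y x). Qed.
HB.instance Definition _ := GRing.Lmodule_isLalgebra.Build k A^c cscaleAl.
HB.instance Definition _ := GRing.Lalgebra_isAlgebra.Build k A^c cscaleAr.

End ConverseAlgebra.

HB.mixin Record isHopf (k : fieldType) H of GRing.Algebra k H := {
  comul : {lrmorphism H -> H \ox H};
  counit : {lrmorphism H -> k^o};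
  antipode : {linear H -> H};
  comulA : forall x : H,
    tassoc (tmap comul idfun (comul x)) = tmap idfun comul (comul x);
  counitl : forall x : H, tlift (fun x1 x2 : H => (counit x1 : k) *: x2) (comul x) = x;
  counitr : forall x : H, tlift (fun x1 x2 : H => (counit x2 : k) *: x1) (comul x) = x;
  antipodel : forall x : H,
    tlift (fun x1 x2 : H => antipode x1 * x2) (comul x) = (counit x : k)%:A;
  antipoder : forall x : H,
    tlift (fun x1 x2 : H => x1 * antipode x2) (comul x) = (counit x : k)%:A
}.

#[short(type="hopfAlgType")]
HB.structure Definition HopfAlgebra (k : fieldType) :=
  {H of GRing.Algebra k H & isHopf k H}.

(** Sweedler notation: [\sw_(x1, x2 <- x) E] is the image of [comul x] under the
    linear map induced by [fun x1 x2 => E]; it is only used for [E] bilinear in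
    [x1] and [x2]. *)

Definition sweedler (k : fieldType) (H : hopfAlgType k) (W : lmodType k)
    (f : H -> H -> W) (x : H) : W :=
  tlift f (comul x).

Reserved Notation "\sw_ ( x1 , x2 <- x ) E"
  (at level 41, E at level 41, x1 name, x2 name, x at level 50,
   format "'[' \sw_ ( x1 ,  x2  <-  x ) '/  '  E ']'").
Notation "\sw_ ( x1 , x2 <- x ) E" := (sweedler (fun x1 x2 => E) x) : ring_scope.

Section GenericElements.
Variables (k : fieldType) (H : hopfAlgType k).

Definition tfrac (x : H) : symfrac H := symfrac_of (sgen H x).

(** The property that characterizes the map [x |-> t^-1_x]. *)
Definition is_tinv (tinv : H -> symfrac H) : Prop :=
  forall x : H,
    \sw_(x1, x2 <- x) (tfrac x1 * tinv x2) = (counit x : k)%:A /\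
    \sw_(x1, x2 <- x) (tinv x1 * tfrac x2) = (counit x : k)%:A.

End GenericElements.

Section GenericBaseAlgebra.
Variables (k : fieldType) (H : hopfAlgType k) (tinv : {linear H -> symfrac H}).

Definition Stheta_gens : set (symfrac H) :=
  [set z | exists x, z = tfrac x \/ z = tinv x].

Definition Stheta : Type := subalg Stheta_gens.
HB.instance Definition _ := SubChoice.on Stheta.
HB.instance Definition _ := GRing.ComAlgebra.on Stheta.

Lemma t_subproof (x : H) : tfrac x \in subalg_gen Stheta_gens.
Proof. by apply: mem_subalg_gen; exists x; left. Qed.
Lemma tinv_subproof (x : H) : tinv x \in subalg_gen Stheta_gens.
Proof. by apply: mem_subalg_gen; exists x; right. Qed.

Definition t_ (x : H) : Stheta := Sub (tfrac x) (t_subproof x).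
Definition tinv_ (x : H) : Stheta := Sub (tinv x) (tinv_subproof x).

Lemma t_linear : linear t_.
Proof. by move=> c x y; apply: val_inj; rewrite /= /tfrac !linearP. Qed.
Lemma tinv_linear : linear tinv_.
Proof. by move=> c x y; apply: val_inj; rewrite /= linearP. Qed.
HB.instance Definition _ := GRing.isLinear.Build k H Stheta *:%R t_ t_linear.
HB.instance Definition _ := GRing.isLinear.Build k H Stheta *:%R tinv_ tinv_linear.

Definition sigma (x y : H) : Stheta :=
  \sw_(x1, x2 <- x) \sw_(y1, y2 <- y) (t_ x1 * t_ y1 * tinv_ (x2 * y2)).
Definition sigma_inv (x y : H) : Stheta :=
  \sw_(x1, x2 <- x) \sw_(y1, y2 <- y) (t_ (x1 * y1) * tinv_ x2 * tinv_ y2).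

Definition B_H : {pred Stheta} :=
  subalg_gen [set z | exists x y, z = sigma x y \/ z = sigma_inv x y].

Definition mu_gen (x : H) : Stheta \ox H := \sw_(x1, x2 <- x) (t_ x1 \ox x2).
Definition mu'_gen (x : H) : (Stheta \ox H)^c :=
  \sw_(x1, x2 <- x) (tinv_ x2 \ox antipode x1).

Lemma mu_gen_linear : linear mu_gen.
Proof.
move=> c x y; rewrite /mu_gen /sweedler linearP; apply: tlift_linear.
exact: (@bilin_comp _ _ _ _ _ _ t_ idfun _ (@tens_bilin k Stheta H)).
Qed.
Lemma mu'_gen_linear : linear mu'_gen.
Proof.
move=> c x y; rewrite /mu'_gen /sweedler linearP; apply: tlift_linear.
have [fl fr] := bilin_comp tinv_ antipode (@tens_bilin k Stheta H).
by split=> [v|u]; [exact: fr | exact: fl].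
Qed.
HB.instance Definition _ :=
  GRing.isLinear.Build k H (Stheta \ox H)%type *:%R mu_gen mu_gen_linear.
HB.instance Definition _ :=
  GRing.isLinear.Build k H ((Stheta \ox H)^c)%type *:%R mu'_gen mu'_gen_linear.

Definition mu : {lrmorphism talg H -> Stheta \ox H} := talg_lift mu_gen.
Definition mu' : {lrmorphism talg H -> (Stheta \ox H)^c} := talg_lift mu'_gen.

(** The identification of [Stheta \ox 1] with [Stheta]: the [s] such that
    [s \ox 1 = u] (and [0] if there is none). *)
Definition unox (u : Stheta \ox H) : Stheta := xget 0 [set s | s \ox (1 : H) = u].

Local Notation X := (tgen H).
Local Notation S := antipode.

Definition p_ (x : H) : Stheta := unox (mu (\sw_(x1, x2 <- x) (X x1 * X (S x2)))).
Definition p'_ (x : H) : Stheta := unox (mu' (\sw_(x1, x2 <- x) (X (S x1) * X x2))).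
Definition q_ (x y : H) : Stheta :=
  unox (mu (\sw_(x1, x2 <- x) \sw_(y1, y2 <- y) (X x1 * X y1 * X (S (x2 * y2))))).
Definition q'_ (x y : H) : Stheta :=
  unox (mu' (\sw_(x1, x2 <- x) \sw_(y1, y2 <- y) (X (S (x1 * y1)) * X x2 * X y2))).

End GenericBaseAlgebra.

Arguments t_ {k H} tinv x.
Arguments tinv_ {k H} tinv x.
Arguments sigma {k H} tinv x y.
Arguments sigma_inv {k H} tinv x y.
Arguments B_H {k H} tinv.
Arguments mu_gen {k H} tinv x.
Arguments mu'_gen {k H} tinv x.
Arguments mu {k H} tinv.
Arguments mu' {k H} tinv.
Arguments p_ {k H} tinv x.
Arguments p'_ {k H} tinv x.
Arguments q_ {k H} tinv x y.
Arguments q'_ {k H} tinv x y.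

(* Main.v *)
From HB Require Import structures.
Require Import Defs.
From mathcomp Require Import all_boot all_algebra.
From mathcomp Require Import boolp classical_sets.

Set Implicit Arguments.
Unset Strict Implicit.
Unset Printing Implicit Defensive.

Import GRing.Theory.

Local Open Scope ring_scope.
Local Notation bilin f := (bilinear_for *:%R *:%R f).

(** Over the commutative algebra [A := Stheta tinv], every element in play is a
    value of a convolution product of linear maps [H -> A] or [H \ox H -> A].
    Write [t], [t'] for the maps [x |-> t_x], [x |-> t^-1_x], [S] for the
    antipode, [m : H \ox H -> H] for the multiplication, and [box f f] for the
    map [x \ox y |-> f x * f y]. Then

    - [p = t * (t o S)] and [p' = (t' o S) * t'];
    - [sigma = box t t * (t' o m)] and [sigma_inv = (t o m) * box t' t'];
    - [q = box t t * (t o S o m)] and [q' = (t' o S o m) * box t' t'].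

    Now [t] and [t'] are convolution inverse to each other, hence so are [t o S]
    and [t' o S], because the antipode reverses coproducts and [A] is
    commutative; and [m] is a morphism of coalgebras, so that composition with
    it preserves convolution. Associativity of the convolution of maps on
    [H \ox H] thus gives

      [sigma = q * (p' o m)],      [sigma_inv = (p o m) * q'],
      [q = sigma * (p o m)],       [q' = (p' o m) * sigma_inv],

    (lemmas [sigma_factor], [sigma_inv_factor], [q_factor], [q'_factor]). The
    first line shows that [B_H] is contained in the algebra generated by the
    [p_x], [p'_x], [q_{x,y}], [q'_{x,y}]; the second shows the other inclusion
    once the [p_x] and [p'_x] are known to lie in [B_H]. This follows from

      [p_x = t_1 sigma(x1, S x2)],   [p'_x = t'_1 sigma_inv(S x1, x2)],

    together with [t_1 = sigma(1, 1)] and [t'_1 = sigma_inv(1, 1)].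

    The expressions of [p], ..., [q'] above, which also say that these elements
    lie in [A \ox 1], and the two formulas just given all rest on one
    computation with the fourfold coproduct, [csw_cancel_antipoder] and its
    mirror image [csw_cancel_antipodel]. *)

(** * Multilinear maps *)

(** The bundled linear map underlying a function that is linear. *)
Definition linear_pack (k : fieldType) (U V : lmodType k) (f : U -> V) (fl : linear f) :
    {linear U -> V} :=
  HB.pack_for {linear U -> V} f (GRing.isLinear.Build k U V _ f fl).

Section LinearClosure.
Variables (k : fieldType) (U V W : lmodType k) (A : algType k).

Lemma linear_id : linear (fun x : U => x).
Proof. by []. Qed.

Lemma linear_app (f : {linear V -> W}) (g : U -> V) :
  linear g -> linear (fun x => f (g x)).
Proof. by move=> gl c x y; rewrite gl linearP. Qed.

Lemma linear_comp (f : V -> W) (g : U -> V) :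
  linear f -> linear g -> linear (fun x => f (g x)).
Proof. by move=> fl gl c x y; rewrite gl fl. Qed.

Lemma linear_mull (g : U -> A) a : linear g -> linear (fun x => g x * a).
Proof. by move=> gl c x y; rewrite gl mulrDl -scalerAl. Qed.

Lemma linear_mulr (g : U -> A) a : linear g -> linear (fun x => a * g x).
Proof. by move=> gl c x y; rewrite gl mulrDr -scalerAr. Qed.

Lemma linear_tensl (g : U -> V) (w : W) : linear g -> linear (fun x => g x \ox w).
Proof. by move=> gl c x y; rewrite gl; case: (@tens_bilin k V W) => /(_ w) l _; apply: l. Qed.

Lemma linear_tensr (g : U -> W) (v : V) : linear g -> linear (fun x => v \ox g x).
Proof. by move=> gl c x y; rewrite gl; case: (@tens_bilin k V W) => _ /(_ v) l; apply: l. Qed.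

Lemma linear_scalel (g : U -> k^o) (w : W) : linear g -> linear (fun x => (g x : k) *: w).
Proof. by move=> gl c x y; rewrite gl scalerDl scalerA. Qed.

Lemma linear_scaler (g : U -> W) (a : k) : linear g -> linear (fun x => a *: g x).
Proof. by move=> gl c x y; rewrite gl scalerDr !scalerA mulrC. Qed.

Lemma linear_tlift (V1 V2 : lmodType k) (f : V1 -> V2 -> W) (g : U -> V1 \ox V2) :
  linear g -> bilin f -> linear (fun x => tlift f (g x)).
Proof. by move=> gl fl c x y; rewrite gl tlift_linear. Qed.

Lemma linear_tliftl (V1 V2 : lmodType k) (f : U -> V1 -> V2 -> W) (z : V1 \ox V2) :
  (forall v1 v2, linear (fun x => f x v1 v2)) -> linear (fun x => tlift (f x) z).
Proof.
move=> fl c x y; rewrite /tlift /tensor_eval scaler_sumr -big_split.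
by apply: eq_bigr => p _; apply: fl.
Qed.

End LinearClosure.

(** [multilinear] proves that an expression is linear, or bilinear, in the
    bound variables, by descending towards their single occurrence. For a
    function variable of two to four arguments it uses hypotheses that state
    linearity in each of them. *)
Ltac multilinear :=
  cbv beta;
  (* The patterns below need an abstraction, so eta-expand first. *)
  lazymatch goal with
  | |- @GRing.linear_for _ _ _ _ (fun x => _) => idtac
  | |- @GRing.linear_for ?R ?U ?V ?s ?f =>
      change (@GRing.linear_for R U V s (fun x => f x))
  | _ => idtac
  end;
  lazymatch goal with
  | |- prod _ _ => split; multilinear
  | |- @bilinear_for _ _ _ _ _ _ _ => split; multilinear
  | |- forall _, _ => let x := fresh in intro x; multilinear
  | |- @GRing.linear_for _ _ _ _ (fun x => x) => exact: linear_id
  | |- @GRing.linear_for _ _ _ _ (fun x => _ * _) =>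
      first [ refine (linear_mull _ _); multilinear
            | refine (linear_mulr _ _); multilinear ]
  | |- @GRing.linear_for _ _ _ _ (fun x => _ \ox _) =>
      first [ refine (linear_tensl _ _); multilinear
            | refine (linear_tensr _ _); multilinear ]
  | |- @GRing.linear_for _ _ _ _ (fun x => _ *: _) =>
      first [ refine (linear_scaler _ _); multilinear
            | refine (linear_scalel _ _); multilinear ]
  | |- @GRing.linear_for _ _ _ _ (fun x => tlift _ _) =>
      first [ refine (linear_tliftl _ _); multilinear
            | refine (linear_tlift _ _); multilinear ]
  | |- _ =>
      first
        [ by move=> ? ? ?; exact: linearP
        | match goal with H : _ |- _ =>
            first [ refine (linear_comp (H _) _)
                  | refine (linear_comp (H _ _) _)
                  | refine (linear_comp (H _ _ _) _)]; multilinear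
          end
        | match goal with |- @GRing.linear_for _ _ _ _ (fun x => _ (@?g x)) =>
            refine (@linear_app _ _ _ _ _ g _); multilinear
          end ]
  end.

(** * Coalgebras and Sweedler sums *)

(** Coassociative counital coalgebra structures on a vector space [C]. *)
Record coalgebra (k : fieldType) (C : lmodType k) := Coalgebra {
  cop : {linear C -> (C \ox C)%type};
  cou : {linear C -> k^o};
  cop_assoc : forall x : C,
    tassoc (tmap cop idfun (cop x)) = tmap idfun cop (cop x);
  cou_l : forall x : C, tlift (fun x1 x2 : C => (cou x1 : k) *: x2) (cop x) = x;
  cou_r : forall x : C, tlift (fun x1 x2 : C => (cou x2 : k) *: x1) (cop x) = x
}.

(** A linear map commutes with the lift of a map to a tensor product; no
    bilinearity is needed, the lift being a sum over a representative. *)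
Lemma linear_tliftE (k : fieldType) (U V W W' : lmodType k) (g : W -> W')
    (f : U -> V -> W) z :
  linear g -> g (tlift f z) = tlift (fun u v => g (f u v)) z.
Proof.
by move=> gl; apply: (linear_sum (linear_pack gl)).
Qed.

Lemma tlift_tlift (k : fieldType) (U V U' V' W : lmodType k) (f : U -> V -> W)
    (g : U' -> V' -> U \ox V) z :
  bilin f -> tlift f (tlift g z) = tlift (fun u v => tlift f (g u v)) z.
Proof. by move=> fl; rewrite (linear_tliftE _ _ (tlift_linear fl)). Qed.

Lemma tensZl (k : fieldType) (U V : lmodType k) (c : k) (u : U) (v : V) :
  (c *: u) \ox v = c *: (u \ox v).
Proof. by case: (@tens_bilin k U V) => l _; apply: (scalable_linear (l v)). Qed.

Lemma tensZr (k : fieldType) (U V : lmodType k) (c : k) (u : U) (v : V) :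
  u \ox (c *: v) = c *: (u \ox v).
Proof. by case: (@tens_bilin k U V) => _ l; apply: (scalable_linear (l u)). Qed.

(** Sweedler notation in a coalgebra: the image of [x1 \ox x2] under the linear
    map induced by the bilinear map [f]. Like the lift, it is meaningful for
    bilinear [f] only. *)
Definition csw (k : fieldType) (C : lmodType k) (D : coalgebra C) (W : lmodType k)
    (f : C -> C -> W) (x : C) : W :=
  tlift f (cop D x).

(** [multilinear] for expressions with Sweedler sums. *)
Ltac csw_multilinear := rewrite ?/csw ?/sweedler; multilinear.

Section Sweedler.
Variables (k : fieldType) (C : lmodType k) (D : coalgebra C).
Variables (W : lmodType k).

Lemma eq_csw (f g : C -> C -> W) x : f =2 g -> csw D f x = csw D g x.
Proof. exact: tlift_eq. Qed.

Lemma linear_csw (V : lmodType k) (g : V -> W) (f : C -> C -> V) x :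
  linear g -> g (csw D f x) = csw D (fun a b => g (f a b)) x.
Proof. exact: linear_tliftE. Qed.

Lemma csw_tensl (V : lmodType k) (f : C -> C -> W) (v : V) x :
  csw D f x \ox v = csw D (fun a b => f a b \ox v) x.
Proof. by rewrite (@linear_tliftE k C C W _ (fun w => w \ox v)) //; multilinear. Qed.

Lemma csw_assoc (f : C -> C -> C -> W) x :
  (forall b c, linear (fun a => f a b c)) -> (forall a c, linear (fun b => f a b c)) ->
  (forall a b, linear (fun c => f a b c)) ->
  csw D (fun y c => csw D (fun a b => f a b c) y) x =
  csw D (fun a y => csw D (f a) y) x.
Proof.
move=> f1 f2 f3; have := congr1 (tlift (fun a y => tlift (f a) y)) (cop_assoc D x).
rewrite /tmap /tassoc tlift_tlift; last by multilinear.
rewrite tlift_tlift; last by multilinear.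
rewrite tlift_tlift; last by multilinear.
have e : tlift (fun u v => tlift (fun a => [eta tlift (f a)]) (idfun u \ox cop D v)) (cop D x)
  = csw D (fun a y => csw D (f a) y) x.
  by apply: tlift_eq => u v; rewrite tliftE //; multilinear.
rewrite e => <-; apply: tlift_eq => u v.
rewrite tliftE; last by multilinear.
rewrite tlift_tlift; last by multilinear.
by apply: tlift_eq => a b; rewrite !tliftE //; multilinear.
Qed.

Lemma csw_coul (f : C -> W) x : linear f -> csw D (fun a b => (cou D a : k) *: f b) x = f x.
Proof.
move=> fl; rewrite -[in RHS](cou_l D x) (linear_tliftE _ _ fl); apply: tlift_eq => a b.
by rewrite (scalable_linear fl).
Qed.

Lemma csw_cour (f : C -> W) x : linear f -> csw D (fun a b => (cou D b : k) *: f a) x = f x.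
Proof.
move=> fl; rewrite -[in RHS](cou_r D x) (linear_tliftE _ _ fl); apply: tlift_eq => a b.
by rewrite (scalable_linear fl).
Qed.

(** Two ways to read the fourfold coproduct: cut first in the middle, or detach
    the outer factors and cut what is left. *)
Lemma csw_middle (f : C -> C -> C -> C -> W) x :
  (forall b c d, linear (fun a => f a b c d)) -> (forall a c d, linear (fun b => f a b c d)) ->
  (forall a b d, linear (fun c => f a b c d)) -> (forall a b c, linear (fun d => f a b c d)) ->
  csw D (fun y z => csw D (fun a b => csw D (fun c d => f a b c d) z) y) x =
  csw D (fun a y => csw D (fun z d => csw D (fun b c => f a b c d) z) y) x.
Proof.
move=> f1 f2 f3 f4; rewrite csw_assoc; [|csw_multilinear..].
by apply: eq_csw => a y; rewrite csw_assoc.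
Qed.

End Sweedler.

Section SweedlerAlgebra.
Variables (k : fieldType) (C : lmodType k) (D : coalgebra C) (A : algType k).

Lemma csw_mull (f : C -> C -> A) c x : csw D f x * c = csw D (fun a b => f a b * c) x.
Proof. exact: mulr_suml. Qed.

Lemma csw_mulr (f : C -> C -> A) c x : c * csw D f x = csw D (fun a b => c * f a b) x.
Proof. exact: mulr_sumr. Qed.

End SweedlerAlgebra.

(** * The tensor product of two coalgebras *)

(** Linear maps that agree on pure tensors are equal. *)
Lemma tensor_linear_ext (k : fieldType) (U V W : lmodType k) (f g : U \ox V -> W) :
  linear f -> linear g -> (forall u v, f (u \ox v) = g (u \ox v)) -> f =1 g.
Proof.
move=> fl gl fg z; have zE : tlift (@tens k U V) z = z by rewrite [RHS]tensor_sum.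
by rewrite -zE !(linear_tliftE _ _ fl, linear_tliftE _ _ gl); apply: tlift_eq.
Qed.

(** Two Sweedler sums commute, as finite sums. *)
Lemma cswC (k : fieldType) (C B W : lmodType k) (D : coalgebra C) (E : coalgebra B)
    (f : C -> C -> B -> B -> W) x y :
  csw D (fun a b => csw E (f a b) y) x = csw E (fun c d => csw D (fun a b => f a b c d) x) y.
Proof. exact: exchange_big. Qed.

Section CoassocSweedler.
Variables (k : fieldType) (C : lmodType k) (d : {linear C -> (C \ox C)%type}).

Lemma tassoc_tmapl x : tassoc (tmap d idfun (d x)) =
  tlift (fun y c => tlift (fun a b => a \ox (b \ox c)) (d y)) (d x).
Proof.
rewrite /tmap /tassoc tlift_tlift; last by multilinear.
by apply: tlift_eq => y c; rewrite tliftE //; multilinear.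
Qed.

Lemma tmapr_tlift x : tmap idfun d (d x) =
  tlift (fun a y => tlift (fun b c => a \ox (b \ox c)) (d y)) (d x).
Proof.
apply: tlift_eq => a y; rewrite -[in LHS](_ : tlift (@tens k C C) (d y) = d y).
  by rewrite (linear_tliftE (g := tens a)) //; multilinear.
by rewrite [RHS]tensor_sum.
Qed.

End CoassocSweedler.

Section TensorCoalgebra.
Variables (k : fieldType) (C B : lmodType k) (D : coalgebra C) (E : coalgebra B).

Let cop2 (x : C) (y : B) : (C \ox B) \ox (C \ox B) :=
  csw D (fun x1 x2 => csw E (fun y1 y2 => (x1 \ox y1) \ox (x2 \ox y2)) y) x.

Let cop2_bilin : bilin cop2.
Proof. by rewrite /cop2; csw_multilinear. Qed.

Let cou2 (x : C) (y : B) : k^o := (cou D x : k^o) * cou E y.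

Let cou2_bilin : bilin cou2.
Proof. by rewrite /cou2; csw_multilinear. Qed.

Let cop2E (W : lmodType k) (f : C \ox B -> C \ox B -> W) x y : bilin f ->
  tlift f (tlift_lin cop2_bilin (x \ox y)) =
  csw D (fun x1 x2 => csw E (fun y1 y2 => f (x1 \ox y1) (x2 \ox y2)) y) x.
Proof.
move=> fl; rewrite /= tliftE // /cop2 [LHS]tlift_tlift //.
apply: tlift_eq => x1 x2; rewrite [LHS]tlift_tlift //.
by apply: tlift_eq => y1 y2; rewrite tliftE.
Qed.

Let cop2A z : tassoc (tmap (tlift_lin cop2_bilin) idfun (tlift_lin cop2_bilin z)) =
  tmap idfun (tlift_lin cop2_bilin) (tlift_lin cop2_bilin z).
Proof.
rewrite tassoc_tmapl tmapr_tlift; move: z.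
(* On [x \ox y] both sides are sums over two threefold coproducts;
   coassociativity is used for [x], then for [y]. *)
apply: tensor_linear_ext; [multilinear|multilinear|move=> x y].
rewrite !cop2E; [|multilinear..].
under eq_csw => x1 x2 do under eq_csw => y1 y2 do
  (rewrite cop2E; last by multilinear).
under [in RHS]eq_csw => x1 x2 do under eq_csw => y1 y2 do
  (rewrite cop2E; last by multilinear).
under eq_csw => x1 x2 do rewrite cswC.
under [in RHS]eq_csw => x1 x2 do rewrite cswC.
rewrite [LHS]csw_assoc; [|csw_multilinear..].
apply: eq_csw => a x2; apply: eq_csw => b c.
by rewrite csw_assoc //; csw_multilinear.
Qed.

Let cou2l z :
  tlift (fun z1 z2 => (tlift_lin cou2_bilin z1 : k) *: z2) (tlift_lin cop2_bilin z) = z.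
Proof.
move: z; apply: tensor_linear_ext; [multilinear|multilinear|move=> x y].
rewrite cop2E; last by multilinear.
transitivity (csw D (fun x1 x2 => (cou D x1 : k) *:
    csw E (fun y1 y2 => (cou E y1 : k) *: (x2 \ox y2)) y) x).
  apply: eq_csw => x1 x2; rewrite [RHS](linear_tliftE _ _ (linear_scaler _ (@linear_id _ _))).
  by apply: eq_csw => y1 y2; rewrite /= tliftE // scalerA.
rewrite csw_coul; first by rewrite csw_coul //; csw_multilinear.
csw_multilinear.
Qed.

Let cou2r z :
  tlift (fun z1 z2 => (tlift_lin cou2_bilin z2 : k) *: z1) (tlift_lin cop2_bilin z) = z.
Proof.
move: z; apply: tensor_linear_ext; [multilinear|multilinear|move=> x y].
rewrite cop2E; last by multilinear.
transitivity (csw D (fun x1 x2 => (cou D x2 : k) *: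
    csw E (fun y1 y2 => (cou E y2 : k) *: (x1 \ox y1)) y) x).
  apply: eq_csw => x1 x2; rewrite [RHS](linear_tliftE _ _ (linear_scaler _ (@linear_id _ _))).
  by apply: eq_csw => y1 y2; rewrite /= tliftE // scalerA.
rewrite csw_cour; first by rewrite csw_cour //; csw_multilinear.
csw_multilinear.
Qed.

(** The coalgebra [C \ox B]: the coproduct of [x \ox y] is
    [(x1 \ox y1) \ox (x2 \ox y2)] and its counit is the product of the counits. *)
Definition tensor_coalgebra : coalgebra (C \ox B)%type := Coalgebra cop2A cou2l cou2r.

Lemma csw_tensor (W : lmodType k) (f : C \ox B -> C \ox B -> W) x y : bilin f ->
  csw tensor_coalgebra f (x \ox y) =
  csw D (fun x1 x2 => csw E (fun y1 y2 => f (x1 \ox y1) (x2 \ox y2)) y) x.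
Proof. exact: cop2E. Qed.

Lemma cou_tensor x y : cou tensor_coalgebra (x \ox y) = (cou D x : k^o) * cou E y.
Proof. by rewrite /= tliftE. Qed.

End TensorCoalgebra.

(** * Convolution *)

Section Convolution.
Variables (k : fieldType) (C : lmodType k) (D : coalgebra C) (A : algType k).

(** The convolution product [x |-> f x1 * g x2] of two linear maps from a
    coalgebra to an algebra. *)
Definition conv (f g : C -> A) : C -> A := csw D (fun a b => f a * g b).

(** The neutral element of convolution, the counit followed by the unit. *)
Definition conv1 : C -> A := fun x => (cou D x : k)%:A.

Lemma conv_linear (f g : {linear C -> A}) : linear (conv f g).
Proof. by rewrite /conv; csw_multilinear. Qed.
HB.instance Definition _ (f g : {linear C -> A}) :=
  GRing.isLinear.Build k C A *:%R (conv f g) (@conv_linear f g).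

Lemma conv1_linear : linear conv1.
Proof. by rewrite /conv1; csw_multilinear. Qed.
HB.instance Definition _ := GRing.isLinear.Build k C A *:%R conv1 conv1_linear.

Lemma convA (f g h : {linear C -> A}) : conv f (conv g h) = conv (conv f g) h.
Proof.
apply/funext => x; rewrite /conv.
under eq_csw => a y do rewrite csw_mulr.
under [RHS]eq_csw => y c do (rewrite csw_mull; under eq_csw => a b do rewrite -mulrA).
by rewrite [RHS]csw_assoc //; csw_multilinear.
Qed.

Lemma conv1f (f : {linear C -> A}) : conv conv1 f = f.
Proof.
apply/funext => x; rewrite -[RHS](csw_coul D); last by csw_multilinear.
by apply: eq_csw => a b; rewrite mulr_algl.
Qed.

Lemma convf1 (f : {linear C -> A}) : conv f conv1 = f.
Proof.
apply/funext => x; rewrite -[RHS](csw_cour D); last by csw_multilinear.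
by apply: eq_csw => a b; rewrite mulr_algr.
Qed.

Lemma conv_inverse_unique (f g h : {linear C -> A}) :
  conv f g = conv1 -> conv g h = conv1 -> f = h :> (C -> A).
Proof. by move=> fg gh; rewrite -[LHS]convf1 -gh convA fg conv1f. Qed.

End Convolution.

Section CoalgebraMorphism.
Variables (k : fieldType) (C B : lmodType k) (D : coalgebra C) (E : coalgebra B).

(** Compatibility of [phi] with the coproducts and the counits; linearity is
    not part of it. *)
Definition coalgebra_morphism (phi : C -> B) : Prop :=
  (forall x, tmap phi phi (cop D x) = cop E (phi x)) /\
  (forall x, cou E (phi x) = cou D x).

Variables (phi : C -> B) (phiP : coalgebra_morphism phi).

Lemma csw_morphism (W : lmodType k) (f : B -> B -> W) x : bilin f ->
  csw E f (phi x) = csw D (fun a b => f (phi a) (phi b)) x.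
Proof.
case: phiP => phiD _ fl; rewrite /csw -phiD tlift_tlift //.
by apply: tlift_eq => a b; rewrite tliftE.
Qed.

Variable A : algType k.

Lemma conv_comp (f g : {linear B -> A}) : conv E f g \o phi = conv D (f \o phi) (g \o phi).
Proof. by apply/funext => x; rewrite /= [LHS]csw_morphism //; csw_multilinear. Qed.

Lemma conv1_comp : conv1 E A \o phi = conv1 D A.
Proof. by case: phiP => _ phie; apply/funext => x; rewrite /conv1 /= phie. Qed.

End CoalgebraMorphism.

Section AlgebraMorphism.
Variables (k : fieldType) (C : lmodType k) (D : coalgebra C) (A A' : algType k).
Variable h : {lrmorphism A -> A'}.

Lemma comp_conv (f g : C -> A) : h \o conv D f g = conv D (h \o f) (h \o g).
Proof.
apply/funext => x; rewrite /= (@linear_csw _ _ _ _ _ h); last by csw_multilinear.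
by apply: tlift_eq => a b; rewrite rmorphM.
Qed.

Lemma comp_conv1 : h \o conv1 D A = conv1 D A'.
Proof. by apply/funext => x; rewrite /conv1 /= linearZ rmorph1. Qed.

End AlgebraMorphism.

Section Box.
Variables (k : fieldType) (C B : lmodType k) (A : algType k).

(** The linear map on [C \ox B] that sends [x \ox y] to [f x * g y]. *)
Definition box (f : C -> A) (g : B -> A) : C \ox B -> A := tlift (fun x y => f x * g y).

Lemma box_linear (f : {linear C -> A}) (g : {linear B -> A}) : linear (box f g).
Proof. by rewrite /box; csw_multilinear. Qed.
HB.instance Definition _ (f : {linear C -> A}) (g : {linear B -> A}) :=
  GRing.isLinear.Build k (C \ox B)%type A *:%R (box f g) (@box_linear f g).

Lemma boxE (f : {linear C -> A}) (g : {linear B -> A}) x y : box f g (x \ox y) = f x * g y.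
Proof. by rewrite /box tliftE //; csw_multilinear. Qed.

End Box.

(** * The antipode of a Hopf algebra *)

Section HopfAlgebra.
Variables (k : fieldType) (H : hopfAlgType k).

(** The coalgebra underlying a Hopf algebra; for it, [csw] is [sweedler] by
    definition. *)
Definition hopf_coalgebra : coalgebra H :=
  @Coalgebra k H comul counit (@comulA k H) (@counitl k H) (@counitr k H).
Local Notation HC := hopf_coalgebra.
Local Notation HHC := (tensor_coalgebra hopf_coalgebra hopf_coalgebra).
Local Notation S := (@antipode k H).

(** The multiplication as a linear map [H \ox H -> H]; it is a morphism of
    coalgebras since the coproduct and the counit are multiplicative. *)
Definition hmul : H \ox H -> H := tlift (fun x y => x * y).

Lemma hmul_linear : linear hmul.
Proof. by rewrite /hmul; csw_multilinear. Qed.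
HB.instance Definition _ := GRing.isLinear.Build k (H \ox H)%type H *:%R hmul hmul_linear.

Lemma hmulE x y : hmul (x \ox y) = x * y.
Proof. by rewrite /hmul tliftE //; csw_multilinear. Qed.

Lemma hmul_morphism : coalgebra_morphism HHC HC hmul.
Proof.
split; apply: tensor_linear_ext; try by rewrite /tmap; csw_multilinear.
  move=> x y; rewrite [LHS]csw_tensor; last by csw_multilinear.
  rewrite hmulE /= rmorphM /= [X in _ = X * _]tensor_sum [X in _ = _ * X]tensor_sum.
  rewrite mulr_suml; apply: eq_bigr => p _; rewrite mulr_sumr; apply: eq_bigr => q _.
  by rewrite tensM !hmulE.
by move=> x y; rewrite cou_tensor hmulE /= rmorphM.
Qed.

Lemma id_morphism : coalgebra_morphism HC HC idfun.
Proof. by split=> // x; rewrite [RHS]tensor_sum. Qed.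

(** The antipode is convolution inverse to the identity, from the left. *)
Lemma antipode_convl : conv HC S idfun = conv1 HC H.
Proof. by apply/funext => x; apply: antipodel. Qed.

Lemma antipode1 : S 1 = 1.
Proof.
have := antipodel (1 : H); rewrite (rmorph1 comul) tens1 tliftE; last by csw_multilinear.
by rewrite mulr1 => ->; rewrite (rmorph1 counit) scale1r.
Qed.

Lemma counit_conv1 : counit = conv1 HC k^o :> (H -> k^o).
Proof. by apply/funext => x; rewrite /conv1 /= -[RHS]/(_ * _) mulr1. Qed.

(** Apply the counit to [S * id = 1] in the convolution algebra: what is left of
    the factor [id] is the counit, which is neutral. *)
Lemma counit_antipode x : counit (S x) = counit x.
Proof.
have := congr1 (fun f => (counit \o f) x) antipode_convl.
rewrite comp_conv comp_conv1 -counit_conv1.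
by rewrite (_ : counit \o idfun = conv1 HC k^o) ?convf1 // -counit_conv1.
Qed.

(** The antipode reverses products: both sides are convolution inverse to the
    multiplication [H \ox H -> H]. *)
Lemma antipodeM x y : S (x * y) = S y * S x.
Proof.
pose N : H \ox H -> H := tlift (fun x y => S y * S x).
have Nl : linear N by rewrite /N; csw_multilinear.
have NE u v : N (u \ox v) = S v * S u by rewrite /N tliftE //; csw_multilinear.
suff e : S \o hmul = N by rewrite -NE -e /= hmulE.
apply: (@conv_inverse_unique _ _ HHC _ (S \o hmul) hmul (linear_pack Nl)).
  rewrite -(conv_comp hmul_morphism S idfun) antipode_convl.
  exact: (conv1_comp hmul_morphism).
apply/funext; apply: tensor_linear_ext; [csw_multilinear|csw_multilinear|move=> u v].
rewrite [LHS]csw_tensor; last by csw_multilinear.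
transitivity (csw HC (fun u1 u2 => u1 * csw HC (fun v1 v2 => v1 * S v2) v * S u2) u).
  apply: eq_csw => u1 u2; rewrite csw_mulr csw_mull; apply: eq_csw => v1 v2.
  by rewrite -[LHS]/(hmul (u1 \ox v1) * N (u2 \ox v2)) hmulE NE !mulrA.
rewrite [csw HC (fun v1 v2 => v1 * S v2) v]antipoder /conv1 cou_tensor.
under eq_csw => u1 u2 do rewrite mulr_algr -scalerAl.
by rewrite -linear_csw ?[csw HC _ u]antipoder ?scalerA 1?mulrC //; csw_multilinear.
Qed.

(** The antipode reverses coproducts: both sides are convolution inverse to the
    coproduct [H -> H \ox H]. *)
Lemma csw_antipode (W : lmodType k) (f : H -> H -> W) x : bilin f ->
  csw HC f (S x) = csw HC (fun x1 x2 => f (S x2) (S x1)) x.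
Proof.
move=> fl.
pose N : H -> H \ox H := csw HC (fun x1 x2 => S x2 \ox S x1).
have Nl : linear N by rewrite /N; csw_multilinear.
suff e : comul \o S = N.
  rewrite /csw -[cop HC (S x)]/((comul \o S) x) e [LHS]tlift_tlift //.
  by apply: tlift_eq => a b; rewrite tliftE.
apply: (@conv_inverse_unique _ _ HC _ (comul \o S) comul (linear_pack Nl)).
  by rewrite -[conv _ _ _](comp_conv HC comul S idfun) antipode_convl comp_conv1.
apply/funext => y; rewrite /conv.
transitivity (csw HC (fun y z => csw HC (fun a b => csw HC (fun c d =>
    (a * S d) \ox (b * S c)) z) y) y).
  apply: eq_csw => y1 y2; rewrite /= [comul y1]tensor_sum mulr_suml.
  apply: eq_bigr => p _; rewrite csw_mulr.
  by apply: eq_csw => c d; rewrite tensM.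
rewrite csw_middle; [|csw_multilinear..].
transitivity (csw HC (fun a y => (a * csw HC (fun z d => (counit z : k) *: S d) y) \ox (1 : H)) y).
  apply: eq_csw => a z; rewrite csw_mulr.
  rewrite csw_tensl; apply: eq_csw => u d.
  transitivity ((a * S d) \ox csw HC (fun b c => b * S c) u).
    by rewrite [RHS](@linear_csw _ _ HC _ _ (tens (a * S d))) //; csw_multilinear.
  by rewrite [csw HC _ u]antipoder tensZr -scalerAr tensZl.
under eq_csw => a z do (rewrite csw_coul; last by csw_multilinear).
by rewrite -csw_tensl [csw HC _ y]antipoder tensZl.
Qed.

End HopfAlgebra.

(** * Cancelling the antipode against the neighbouring factor *)

Section CancelAntipode.
Variables (k : fieldType) (H : hopfAlgType k) (C : lmodType k) (D : coalgebra C).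
Variables (phi : {linear C -> H}) (phiP : coalgebra_morphism D (hopf_coalgebra H) phi).
Local Notation HC := (hopf_coalgebra H).
Local Notation S := (@antipode k H).
Variables (W : lmodType k).

(** Since the antipode reverses coproducts, the first tensor leg of the coproduct
    of [S (phi x2)] contributes [S] of the last Sweedler factor, and its second
    leg [S] of the factor next to [phi b], with which it cancels. *)
Lemma csw_cancel_antipoder (F : C -> H -> H -> W) x :
  (forall b c, linear (fun a => F a b c)) -> (forall a c, linear (fun b => F a b c)) ->
  (forall a b, linear (F a b)) ->
  csw D (fun x1 x2 => csw D (fun a b =>
    csw HC (fun c d => F a c (phi b * d)) (S (phi x2))) x1) x =
  csw D (fun a d => F a (S (phi d)) 1) x.
Proof.
move=> F1 F2 F3.
under eq_csw => x1 x2 do under eq_csw => a b do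
  (rewrite csw_antipode; [rewrite (csw_morphism phiP)|]; [|csw_multilinear..]).
rewrite csw_middle; [|csw_multilinear..].
apply: eq_csw => a y; rewrite -[RHS](@csw_coul _ _ D _ (fun d => F a (S (phi d)) 1)); last by csw_multilinear.
apply: eq_csw => z d.
rewrite -(@linear_csw _ _ D _ _ (F a (S (phi d)))) //.
have -> : csw D (fun b c => phi b * S (phi c)) z = (cou D z : k)%:A.
  rewrite -(@csw_morphism _ _ _ _ _ _ phiP _ (fun b c => b * S c)); last by csw_multilinear.
  by rewrite [csw HC _ _]antipoder -[counit _]/(cou HC (phi z)); case: phiP => _ ->.
by rewrite (scalable_linear (F3 _ _)).
Qed.

(** The mirror image: the first leg of the coproduct of [S (phi x1)] cancels
    against the first leg of the coproduct of [x2]. *)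
Lemma csw_cancel_antipodel (F : H -> C -> H -> W) x :
  (forall b c, linear (fun a => F a b c)) -> (forall a c, linear (fun b => F a b c)) ->
  (forall a b, linear (F a b)) ->
  csw D (fun x1 x2 => csw HC (fun a b =>
    csw D (fun c d => F b d (a * phi c)) x2) (S (phi x1))) x =
  csw D (fun b d => F (S (phi b)) d 1) x.
Proof.
move=> F1 F2 F3.
under eq_csw => x1 x2 do
  (rewrite csw_antipode; [rewrite (csw_morphism phiP)|]; [|csw_multilinear..]).
rewrite csw_middle; [|csw_multilinear..].
apply: eq_csw => b y; rewrite -[RHS](@csw_coul _ _ D _ (fun d => F (S (phi b)) d 1)); last by csw_multilinear.
apply: eq_csw => z d.
rewrite -(@linear_csw _ _ D _ _ (F (S (phi b)) d)) //.
have -> : csw D (fun a c => S (phi a) * phi c) z = (cou D z : k)%:A.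
  rewrite -(@csw_morphism _ _ _ _ _ _ phiP _ (fun a c => S a * c)); last by csw_multilinear.
  by rewrite [csw HC _ _]antipodel -[counit _]/(cou HC (phi z)); case: phiP => _ ->.
by rewrite (scalable_linear (F3 _ _)).
Qed.

End CancelAntipode.

(** * The generators as convolution products *)

Section GenericBase.
Variables (k : fieldType) (H : hopfAlgType k) (tinv : {linear H -> symfrac H}).
Local Notation HC := (hopf_coalgebra H).
Local Notation HHC := (tensor_coalgebra HC HC).
Local Notation S := (@antipode k H).
Local Notation A := (Stheta tinv).
Local Notation T := (t_ tinv).
Local Notation I := (tinv_ tinv).
Local Notation m := (@hmul k H).

(** [s |-> s \ox 1] is injective: a linear form on [H] with value [1] at [1]
    gives a retraction. *)
Lemma unoxE (s : A) : unox (s \ox (1 : H)) = s.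
Proof.
apply: xget_unique => //= s' /= e.
have [f f1] := ex_linear_form (oner_neq0 H).
pose g (u : A) (h : H) : A := (f h : k) *: u.
have gl : bilin g by rewrite /g; multilinear.
by have := congr1 (tlift g) e; rewrite !tliftE // /g f1 !scale1r.
Qed.

Lemma sigmaE x y : sigma tinv x y = conv HHC (box T T) (I \o m) (x \ox y).
Proof.
rewrite [RHS]csw_tensor; last by csw_multilinear.
by apply: (@eq_csw _ _ HC) => x1 x2; apply: (@eq_csw _ _ HC) => y1 y2; rewrite boxE /= hmulE.
Qed.

Lemma sigma_invE x y : sigma_inv tinv x y = conv HHC (T \o m) (box I I) (x \ox y).
Proof.
rewrite [RHS]csw_tensor; last by csw_multilinear.
by apply: (@eq_csw _ _ HC) => x1 x2; apply: (@eq_csw _ _ HC) => y1 y2; rewrite boxE /= hmulE mulrA.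
Qed.

Lemma mu_csw f x : mu tinv (csw HC f x) = csw HC (fun a b => mu tinv (f a b)) x.
Proof. by rewrite (@linear_csw _ _ HC _ _ (mu tinv)) //; csw_multilinear. Qed.

Lemma mu_tgen x : mu tinv (tgen H x) = csw HC (fun a b => T a \ox b) x.
Proof. by rewrite /mu talg_liftE. Qed.

Lemma muM u v : mu tinv (u * v) = mu tinv u * mu tinv v.
Proof. exact: rmorphM. Qed.

Lemma p_E x : p_ tinv x = conv HC T (T \o S) x.
Proof.
rewrite /p_ -[RHS]unoxE; congr (unox _); rewrite mu_csw csw_tensl.
rewrite -(csw_cancel_antipoder (id_morphism H) (F := fun a c z => (T a * T c) \ox z)).
- apply: eq_csw => x1 x2; rewrite muM !mu_tgen csw_mull; apply: eq_csw => a b.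
  by rewrite csw_mulr; apply: eq_csw => c d; rewrite tensM.
all: csw_multilinear.
Qed.

Lemma q_E x y : q_ tinv x y = conv HHC (box T T) (T \o S \o m) (x \ox y).
Proof.
rewrite /q_ -[RHS]unoxE; congr (unox _); rewrite mu_csw csw_tensl.
rewrite -(csw_cancel_antipoder (@hmul_morphism k H)
  (F := fun a c z => (box T T a * T c) \ox z)); [|csw_multilinear..].
rewrite csw_tensor; last by csw_multilinear.
apply: eq_csw => x1 x2; rewrite mu_csw; apply: eq_csw => y1 y2.
rewrite csw_tensor; last by csw_multilinear.
rewrite !muM !mu_tgen !csw_mull; apply: eq_csw => a b.
rewrite [X in X * _]csw_mulr csw_mull; apply: eq_csw => a' b'.
by rewrite csw_mulr -[x2 * y2]hmulE; apply: eq_csw => c d; rewrite /= boxE hmulE !tensM.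
Qed.

(** The values of [mu'] are read in [A \ox H] rather than in its converse
    algebra, so that [mu'] reverses products. *)
Lemma mu'_csw f x :
  mu' tinv (csw HC f x) = csw HC (fun a b => mu' tinv (f a b)) x :> (A \ox H)%type.
Proof. by apply: (@linear_csw _ _ HC ((A \ox H)^c)%type (talg H) (mu' tinv)); exact: linearP. Qed.

Lemma mu'_tgen x : mu' tinv (tgen H x) = csw HC (fun a b => I b \ox S a) x :> (A \ox H)%type.
Proof. by rewrite /mu' talg_liftE. Qed.

Lemma mu'M u v : mu' tinv (u * v) = (mu' tinv v : (A \ox H)%type) * mu' tinv u :> (A \ox H)%type.
Proof. by rewrite rmorphM. Qed.

Lemma p'_E x : p'_ tinv x = conv HC (I \o S) I x.
Proof.
rewrite /p'_ -[RHS]unoxE; congr (unox _); rewrite mu'_csw csw_tensl.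
(* The second tensor factor is the image under [S] of the cancelling product. *)
rewrite -antipode1.
rewrite -(csw_cancel_antipodel (id_morphism H) (F := fun b d z => (I b * I d) \ox S z)).
- apply: eq_csw => x1 x2; rewrite mu'M !mu'_tgen csw_mulr; apply: eq_csw => a b.
  by rewrite csw_mull; apply: eq_csw => c d; rewrite tensM antipodeM mulrC.
all: csw_multilinear.
Qed.

Lemma q'_E x y : q'_ tinv x y = conv HHC (I \o S \o m) (box I I) (x \ox y).
Proof.
rewrite /q'_ -[RHS]unoxE; congr (unox _); rewrite mu'_csw csw_tensl -antipode1.
rewrite -(csw_cancel_antipodel (@hmul_morphism k H)
  (F := fun b d z => (I b * box I I d) \ox S z)); [|csw_multilinear..].
rewrite csw_tensor; last by csw_multilinear.
apply: eq_csw => x1 x2; rewrite mu'_csw; apply: eq_csw => y1 y2.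
rewrite !mu'M !mu'_tgen [X in _ * X]csw_mulr csw_mulr -[x1 * y1]hmulE.
apply: eq_csw => a b; rewrite csw_tensor; last by csw_multilinear.
rewrite [X in _ * X]csw_mull csw_mulr; apply: eq_csw => c d.
rewrite csw_mull; apply: eq_csw => c' d'.
rewrite boxE /= hmulE !tensM !antipodeM !mulrA; congr (_ \ox _).
by rewrite mulrC mulrA mulrAC.
Qed.

End GenericBase.

(** * The relations between the two sets of generators *)

Section GenericBaseGenerators.
Variables (k : fieldType) (H : hopfAlgType k) (tinv : {linear H -> symfrac H}).
Hypothesis tinvP : is_tinv tinv.
Local Notation HC := (hopf_coalgebra H).
Local Notation HHC := (tensor_coalgebra HC HC).
Local Notation S := (@antipode k H).
Local Notation A := (Stheta tinv).
Local Notation T := (t_ tinv).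
Local Notation I := (tinv_ tinv).
Local Notation m := (@hmul k H).

Lemma val_csw (f : H -> H -> A) x :
  val (csw HC f x) = csw HC (fun a b => val (f a b)) x :> symfrac H.
Proof. exact: raddf_sum. Qed.

Lemma csw1 (W : lmodType k) (f : H -> H -> W) : bilin f -> csw HC f 1 = f 1 1.
Proof. by move=> fl; rewrite /csw /= (rmorph1 comul) tens1 tliftE. Qed.

Lemma conv_t_tinv : conv HC T I = conv1 HC A.
Proof.
apply/funext => x; apply: val_inj; rewrite [LHS]val_csw.
by rewrite [LHS](proj1 (tinvP x)) linearZ rmorph1.
Qed.

Lemma conv_tinv_t : conv HC I T = conv1 HC A.
Proof.
apply/funext => x; apply: val_inj; rewrite [LHS]val_csw.
by rewrite [LHS](proj2 (tinvP x)) linearZ rmorph1.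
Qed.

Lemma t1_tinv1 : T 1 * I 1 = 1.
Proof.
have := congr1 (fun f => f 1) conv_t_tinv.
by rewrite [LHS]csw1 /conv1 /= ?(rmorph1 counit) ?scale1r //; csw_multilinear.
Qed.

(** Composition with the antipode reverses convolution, for maps into a
    commutative algebra. *)
Lemma conv_comp_antipode (f g : {linear H -> A}) :
  conv HC (f \o S) (g \o S) = conv HC g f \o S.
Proof.
apply/funext => x; rewrite /= [RHS]csw_antipode; last by csw_multilinear.
by apply: eq_csw => a b; rewrite mulrC.
Qed.

Lemma conv1_antipode : conv1 HC A \o S = conv1 HC A.
Proof. by apply/funext => x; rewrite /conv1 /= counit_antipode. Qed.

Lemma conv_tS_tinvS : conv HC (T \o S) (I \o S) = conv1 HC A.
Proof. by rewrite conv_comp_antipode conv_tinv_t conv1_antipode. Qed.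

Lemma comp_conv_hmul (f g : {linear H -> A}) :
  conv HHC (f \o m) (g \o m) = conv HC f g \o m.
Proof. by rewrite (conv_comp (@hmul_morphism k H)). Qed.

Lemma conv1_hmul : conv1 HC A \o m = conv1 HHC A.
Proof. exact: (conv1_comp (@hmul_morphism k H)). Qed.

Lemma sigma_factor : conv HHC (box T T) (I \o m) =
  conv HHC (conv HHC (box T T) (T \o S \o m)) (conv HC (I \o S) I \o m).
Proof.
rewrite -[conv HC (I \o S) I \o m]comp_conv_hmul -convA (convA _ (T \o S \o m)).
by rewrite (comp_conv_hmul (T \o S) (I \o S)) conv_tS_tinvS conv1_hmul conv1f.
Qed.

Lemma sigma_inv_factor : conv HHC (T \o m) (box I I) =
  conv HHC (conv HC T (T \o S) \o m) (conv HHC (I \o S \o m) (box I I)).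
Proof.
rewrite -[conv HC T (T \o S) \o m]comp_conv_hmul -convA (convA _ (T \o S \o m)).
by rewrite (comp_conv_hmul (T \o S) (I \o S)) conv_tS_tinvS conv1_hmul conv1f.
Qed.

Lemma q_factor : conv HHC (box T T) (T \o S \o m) =
  conv HHC (conv HHC (box T T) (I \o m)) (conv HC T (T \o S) \o m).
Proof.
rewrite -[conv HC T (T \o S) \o m]comp_conv_hmul -convA (convA _ (I \o m)).
by rewrite (comp_conv_hmul I T) conv_tinv_t conv1_hmul conv1f.
Qed.

Lemma q'_factor : conv HHC (I \o S \o m) (box I I) =
  conv HHC (conv HC (I \o S) I \o m) (conv HHC (T \o m) (box I I)).
Proof.
rewrite -[conv HC (I \o S) I \o m]comp_conv_hmul -convA (convA _ (I \o m)).
by rewrite (comp_conv_hmul I T) conv_tinv_t conv1_hmul conv1f.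
Qed.

(** By cancellation of the antipode, the Sweedler sum of [sigma(x1, S x2)] is
    [p_x t^-1_1]. *)
Lemma p_sigma x : p_ tinv x = T 1 * csw HC (fun x1 x2 => sigma tinv x1 (S x2)) x.
Proof.
have -> : csw HC (fun x1 x2 => sigma tinv x1 (S x2)) x = p_ tinv x * I 1.
  rewrite p_E csw_mull.
  by apply: (csw_cancel_antipoder (id_morphism H) (F := fun a c z => T a * T c * I z)); csw_multilinear.
by rewrite mulrCA t1_tinv1 mulr1.
Qed.

(** By cancellation of the antipode, the Sweedler sum of [sigma_inv(S x1, x2)] is
    [t_1 p'_x]. *)
Lemma p'_sigma_inv x : p'_ tinv x = I 1 * csw HC (fun x1 x2 => sigma_inv tinv (S x1) x2) x.
Proof.
have -> : csw HC (fun x1 x2 => sigma_inv tinv (S x1) x2) x = T 1 * p'_ tinv x.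
  rewrite p'_E csw_mulr; under [RHS]eq_csw => a b do rewrite mulrA.
  by apply: (csw_cancel_antipodel (id_morphism H) (F := fun b d z => T z * I b * I d)); csw_multilinear.
by rewrite mulrA [I 1 * _]mulrC t1_tinv1 mul1r.
Qed.

Lemma sigma11 : sigma tinv 1 1 = T 1.
Proof.
rewrite [LHS]csw1; last by csw_multilinear.
by rewrite [LHS]csw1 ?mulr1 -?mulrA ?t1_tinv1 ?mulr1 //; csw_multilinear.
Qed.

Lemma sigma_inv11 : sigma_inv tinv 1 1 = I 1.
Proof.
rewrite [LHS]csw1; last by csw_multilinear.
by rewrite [LHS]csw1 ?mulr1 ?t1_tinv1 ?mul1r //; csw_multilinear.
Qed.

Section Membership.
Variable G : set A.

Lemma csw_mem (C : lmodType k) (D : coalgebra C) (f : C -> C -> A) x :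
  (forall a b, f a b \in subalg_gen G) -> csw D f x \in subalg_gen G.
Proof. by move=> fG; apply: rpred_sum => p _; apply: fG. Qed.

Lemma conv_mem (f g : {linear (H \ox H)%type -> A}) x y :
  (forall a b, f (a \ox b) \in subalg_gen G) -> (forall a b, g (a \ox b) \in subalg_gen G) ->
  conv HHC f g (x \ox y) \in subalg_gen G.
Proof.
move=> fG gG; rewrite [conv _ _ _ _]csw_tensor; last by csw_multilinear.
by apply: csw_mem => x1 x2; apply: csw_mem => y1 y2; apply: rpredM.
Qed.

End Membership.

End GenericBaseGenerators.

Theorem corollary4p4 (k : fieldType) (H : hopfAlgType k)
    (tinv : {linear H -> symfrac H}) (tinvP : is_tinv tinv) :
  B_H tinv =i subalg_gen
    [set z : Stheta tinv |
       (exists x : H, z = p_ tinv x \/ z = p'_ tinv x) \/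
       (exists x y : H, z = q_ tinv x y \/ z = q'_ tinv x y)].
Proof.
set G := (X in subalg_gen X).
have sG x y : sigma tinv x y \in B_H tinv by apply: mem_subalg_gen; exists x, y; left.
have siG x y : sigma_inv tinv x y \in B_H tinv by apply: mem_subalg_gen; exists x, y; right.
have t1 : t_ tinv 1 \in B_H tinv by rewrite -(sigma11 tinvP).
have ti1 : tinv_ tinv 1 \in B_H tinv by rewrite -(sigma_inv11 tinvP).
have pB x : p_ tinv x \in B_H tinv.
  by rewrite (p_sigma tinvP) rpredM //; apply: csw_mem => a b.
have p'B x : p'_ tinv x \in B_H tinv.
  by rewrite (p'_sigma_inv tinvP) rpredM //; apply: csw_mem => a b.
have pG x : p_ tinv x \in subalg_gen G by apply: mem_subalg_gen; left; exists x; left.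
have p'G x : p'_ tinv x \in subalg_gen G by apply: mem_subalg_gen; left; exists x; right.
have qG x y : q_ tinv x y \in subalg_gen G by apply: mem_subalg_gen; right; exists x, y; left.
have q'G x y : q'_ tinv x y \in subalg_gen G by apply: mem_subalg_gen; right; exists x, y; right.
move=> z; apply/idP/idP; apply: subalg_gen_min; try exact: subalg_gen_closed.
  move=> _ [x [y [->|->]]].
    rewrite sigmaE (sigma_factor tinvP); apply: conv_mem => a b.
      by have := qG a b; rewrite q_E.
    by have := p'G (hmul (a \ox b)); rewrite p'_E.
  rewrite sigma_invE (sigma_inv_factor tinvP); apply: conv_mem => a b.
    by have := pG (hmul (a \ox b)); rewrite p_E.
  by have := q'G a b; rewrite q'_E.
move=> _ [[x [->|->]]|[x [y [->|->]]]] //.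
  rewrite q_E (q_factor tinvP); apply: conv_mem => a b.
    by have := sG a b; rewrite sigmaE.
  by have := pB (hmul (a \ox b)); rewrite p_E.
rewrite q'_E (q'_factor tinvP); apply: conv_mem => a b.
  by have := p'B (hmul (a \ox b)); rewrite p'_E.
by have := siG a b; rewrite sigma_invE.
Qed.
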